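(* Consider the finite-horizon MDP, the functions $f_\theta$, the optimal risk $\mathcal R^*$ and its empirical counterpart $\hat{\mathcal R}^*_n$ described in the context. For any $\epsilon>0$ and $\delta\in(0,1)$, take $$n=\mathcal O\left(\frac{T^3L_C^2}{\epsilon^2}\log\left(\frac{T^7|\mathcal S||\mathcal A|\,L_C^3\,\log\!\big(T^2|\mathcal A|L_C/\epsilon\big)\,(L_\Theta R_\Theta/\epsilon)^{d_\Theta}}{\delta\,\epsilon^3}\right)\right).$$ Then with probability at least $1-\delta$, $$|\hat{\mathcal R}^*_n(s)-\mathcal R^*(s)|\le\epsilon\qquad\text{for all }s\in\mathcal S_0.$$
   Context: MDP: $T$ is a positive integer; for $0\le t\le T$, $\mathcal S_t$ is a finite state space, $\mathcal A_t$ a finite action space, and $c_t:\mathcal S_t\times\mathcal A_t\to[0,1]$ a cost function; for $0\le t\le T-1$, $\mathbb P_t(\cdot|s,a)$ is a probability distribution on $\mathcal S_{t+1}$ for each $(s,a)\in\mathcal S_t\times\mathcal A_t$. $|\mathcal S|=\max_t|\mathcal S_t|$, $|\mathcal A|=\max_t|\mathcal A_t|$. $\Pi(\mathcal M)$ is the set of randomized history-dependent policies: $\pi$ maps $H_t=(S_0,A_0,\dots,S_t)$ to a probability distribution on $\mathcal A_t$; $A_t\sim\pi(\cdot|H_t)$, $S_{t+1}\sim\mathbb P_t(\cdot|S_t,A_t)$. Risk: $\mathcal R^\pi(s)=\min_{\theta\in\Theta}\mathbb E^\pi_{\mathbb P}[f_\theta(\sum_{t=0}^Tc_t(S_t,A_t))\mid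 S_0=s]$, with $\Theta\subseteq\mathbb R^{d_\Theta}$, $f_\theta:\mathbb R\to\mathbb R$; $\mathcal R^*(s)=\min_{\pi\in\Pi(\mathcal M)}\mathcal R^\pi(s)$. Standing assumption: $|f_\theta(z)-f_\theta(z')|\le L_C|z-z'|$ and $|f_\theta(z)-f_{\theta'}(z)|\le L_\Theta\|\theta-\theta'\|$ for all $z,z'\in[0,T+1]$, $\theta,\theta'\in\Theta$; $\Theta$ is bounded with radius $R_\Theta$ in the Euclidean norm $\|\cdot\|$. ($L_C$ and $L_\Theta$ may depend on $T$.) Sampling: for every $0\le t\le T-1$ and $(s,a)\in\mathcal S_t\times\mathcal A_t$ one draws $n$ i.i.d. samples from $\mathbb P_t(\cdot|s,a)$ (independently over $(t,s,a)$); $\hat{\mathbb P}_{t,n}(\cdot|s,a)$ is the resulting empirical distribution. $\hat{\mathcal R}^\pi_n(s)$ is $\mathcal R^\pi(s)$ with $\{\mathbb P_t\}$ replaced by $\{\hat{\mathbb P}_{t,n}\}$, and $\hat{\mathcal R}^*_n(s)=\min_{\pi\in\Pi(\mathcal M)}\hat{\mathcal R}^\pi_n(s)$.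
   Formalization: In the sample bound, T^2|A|L_C/ε inside the inner log and L_ΘR_Θ/ε (raised to d_Θ) are replaced by their maximum with 2, since the printed expression can be undefined or negative and the claim then fails (e.g. Θ a singleton with tiny L_ΘR_Θ). *)

(* Defs.v *)
From HB Require Import structures.
From mathcomp Require Import all_boot all_order all_algebra.
From mathcomp Require Import all_classical all_reals all_analysis.
Set Implicit Arguments.
Unset Strict Implicit.
Unset Printing Implicit Defensive.
Import Order.TTheory GRing.Theory Num.Theory.
Import numFieldNormedType.Exports.
Local Open Scope classical_set_scope.
Local Open Scope ring_scope.

Definition is_distr (R : realType) (V : finType) (p : V -> R) : Prop :=
  (forall v, 0 <= p v) /\ \sum_v p v = 1.

(* The norm `|v| on row vectors is the sup norm, hence this definition. *)
Definition euclidean_norm (R : realType) (d : nat) (v : 'rV[R]_d) : R :=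
  Num.sqrt (\sum_i v ord0 i ^+ 2).

(* Stages are indexed by nat; only the stages t <= T of the states, actions
   and costs, and the stages t < T of the transitions, are ever used.  The
   spaces of the unused stages are only required to be nonempty. *)
Record mdp (R : realType) (T : nat) := MDP {
  state : nat -> finType;
  action : nat -> finType;
  cost : forall t, state t -> action t -> R;
  trans : forall t, state t -> action t -> state t.+1 -> R;
  state_gt0 : forall t, (0 < #|state t|)%N;
  action_gt0 : forall t, (0 < #|action t|)%N;
  cost_itv : forall t (s : state t) (a : action t),
    (t <= T)%N -> 0 <= cost s a <= 1;
  trans_distr : forall t (s : state t) (a : action t),
    (t < T)%N -> is_distr (trans s a)
}.

Section Mdp.
Context {R : realType} {T : nat} (M : mdp R T).

Definition max_card_state : nat := \max_(t < T.+1) #|state M t|.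
Definition max_card_action : nat := \max_(t < T.+1) #|action M t|.

Definition transition_kernel := forall t, state M t -> action M t -> state M t.+1 -> R.

(* Histories (S_0, A_0, ..., A_(t-1), S_t), nested to the left. *)
Fixpoint hist (t : nat) : finType :=
  match t with
  | 0 => state M 0
  | t'.+1 => ((hist t' * action M t') * state M t'.+1)%type
  end.

Definition last_state (t : nat) : hist t -> state M t :=
  match t with
  | 0 => fun h => h
  | t'.+1 => fun h => h.2
  end.

(* The total cost of the stages 0, ..., t-1. *)
Fixpoint hist_cost (t : nat) : hist t -> R :=
  match t with
  | 0 => fun=> 0
  | t'.+1 => fun h =>
      hist_cost h.1.1 + cost (last_state h.1.1) h.1.2
  end.

Definition policy := forall t, hist t -> action M t -> R.

Definition policies : set policy :=
  [set pi | forall t (h : hist t), (t <= T)%N -> is_distr (pi t h)].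

(* The probability of a history under pi and P, given S_0 = s. *)
Fixpoint hist_prob (P : transition_kernel) (pi : policy) (s : state M 0) (t : nat) :
    hist t -> R :=
  match t with
  | 0 => fun h => (h == s)%:R
  | t'.+1 => fun h =>
      hist_prob P pi s h.1.1 * pi t' h.1.1 h.1.2
      * P t' (last_state h.1.1) h.1.2 h.2
  end.

(* E^pi_P [ g (sum_(0 <= t <= T) c_t(S_t, A_t)) | S_0 = s ] *)
Definition expect_total_cost (P : transition_kernel) (pi : policy) (s : state M 0)
    (g : R -> R) : R :=
  \sum_(h : hist T) \sum_(a : action M T)
    hist_prob P pi s h * pi T h a * g (hist_cost h + cost (last_state h) a).

Section Risk.
Context {d : nat} (Theta : set 'rV[R]_d) (f : 'rV[R]_d -> R -> R).

Definition risk (P : transition_kernel) (pi : policy) (s : state M 0) : R :=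
  inf [set expect_total_cost P pi s (f theta) | theta in Theta].

Definition opt_risk (P : transition_kernel) (s : state M 0) : R :=
  inf [set risk P pi s | pi in policies].

End Risk.

End Mdp.

Definition risk_family_assumption (R : realType) (T d : nat)
    (Theta : set 'rV[R]_d) (f : 'rV[R]_d -> R -> R) (L_C L_Theta R_Theta : R) :
    Prop :=
  [/\ Theta !=set0,
      exists theta0 : 'rV[R]_d,
        forall theta, Theta theta -> euclidean_norm (theta - theta0) <= R_Theta,
      forall theta (z z' : R), Theta theta ->
        0 <= z <= T%:R + 1 -> 0 <= z' <= T%:R + 1 ->
        `|f theta z - f theta z'| <= L_C * `|z - z'| &
      forall theta theta' (z : R), Theta theta -> Theta theta' ->
        0 <= z <= T%:R + 1 ->
        `|f theta z - f theta' z| <= L_Theta * euclidean_norm (theta - theta')].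

Definition mutually_independent {d : measure_display} {Omega : measurableType d}
    {R : realType} (Pr : probability Omega R) (I : finType) (V : I -> finType)
    (Y : forall i, Omega -> V i) : Prop :=
  forall (J : {set I}) (B : forall i, {set V i}),
    fine (Pr [set w | forall i, i \in J -> Y i w \in B i]) =
    \prod_(i in J) fine (Pr [set w | Y i w \in B i]).

Section Sampling.
Context {R : realType} {T : nat} (M : mdp R T) (n : nat).
Context {d : measure_display} {Omega : measurableType d}.

(* X t s a i w is the i-th sample drawn from the transition law at (t, s, a). *)
Definition samples :=
  forall t, state M t -> action M t -> 'I_n -> Omega -> state M t.+1.

Definition sample_index : finType :=
  {t : 'I_T & (state M t * action M t * 'I_n)%type}.

Definition sample_at (X : samples) (j : sample_index) :
    Omega -> state M (tag j).+1 :=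
  let: (s, a, i) := tagged j in X (tag j) s a i.

Definition iid_samples (Pr : probability Omega R) (X : samples) : Prop :=
  [/\ forall t (s : state M t) (a : action M t) (i : 'I_n) s', (t < T)%N ->
        measurable [set w | X t s a i w = s'],
      forall t (s : state M t) (a : action M t) (i : 'I_n) s', (t < T)%N ->
        Pr [set w | X t s a i w = s'] = (trans s a s')%:E &
      mutually_independent Pr (sample_at X)].

Definition empirical_kernel (X : samples) (w : Omega) : transition_kernel M :=
  fun t s a s' => (\sum_(i < n) (X t s a i w == s')%:R) / n%:R.

End Sampling.

(* The expression inside O(.).  The maxima with 2 fix its meaning where the
   bare expression degenerates: it coincides with the bare one as soon as
   T^2 |A| L_C / eps >= 2 and L_Theta R_Theta / eps >= 2, but for large eps (or
   small L_Theta R_Theta) the bare logarithms become negative or undefined. *)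
Definition sample_complexity {R : realType} (T cardS cardA d : nat)
    (L_C L_Theta R_Theta eps delta : R) : R :=
  T%:R ^+ 3 * L_C ^+ 2 / eps ^+ 2 *
  ln (T%:R ^+ 7 * cardS%:R * cardA%:R * L_C ^+ 3
      * ln (Num.max 2 (T%:R ^+ 2 * cardA%:R * L_C / eps))
      * Num.max 2 (L_Theta * R_Theta / eps) ^+ d
      / (delta * eps ^+ 3)).

(* Main.v *)
(* The infima over theta and over the policies commute, so it suffices to
   compare, for theta in a finite net of Theta, the optimal values of the MDPs
   with utility f_theta.  Let V_t (s, y) be the optimal value from state s with
   accumulated cost y under the true kernel, normalized to [-1, 1], and for
   small kappa (of either sign) put w v = - ln (1 - kappa v).  Since
   exp (- w v) is affine in v, Markov's inequality applied to
     E (prod_i (1 - kappa V (X_i))) = (1 - kappa E V (X_1)) ^ n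
   gives, with probability at least 1 - exp (- l),
     sum_s' Phat (s') w (V s') >= w (sum_s' P (s') V s') - l / n.
   On the intersection of these events over all (t, s, a), y in a grid and
   theta in the net, w (V_t (S_t, Y_t)) is, under the empirical kernel, a
   submartingale up to a drift of about l / n per stage, for every policy if
   kappa > 0 and for the optimal policy of the true kernel if kappa < 0.  As
   w v = kappa v + O (kappa ^ 2), the total error is of order
   kappa + T l / (n kappa) relative to L_C T; taking kappa of order
   eps / (L_C T) gives T ^ 3 (instead of T ^ 4) without any variance estimate.  If L_C T <= eps, or if all
   state spaces are singletons, the bound holds surely; otherwise the argument
   of the logarithm is bounded away from 1, so that its 32-nd power absorbs all
   the numerical constants of the union bound. *)

Require Import Defs.
From HB Require Import structures.
From mathcomp Require Import all_boot all_order all_algebra.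
From mathcomp Require Import all_classical all_reals all_analysis.
From mathcomp Require Import ring lra.
Set Implicit Arguments.
Unset Strict Implicit.
Unset Printing Implicit Defensive.
Import Order.TTheory GRing.Theory Num.Theory.
Import numFieldNormedType.Exports.
Local Open Scope classical_set_scope.
Local Open Scope ring_scope.

(** * Averages against a distribution on a finite set *)

Section Distr.
Context {R : realType} {V : finType} {p : V -> R}.
Hypothesis pD : is_distr p.

Lemma distr_ge0 v : 0 <= p v. Proof. by case: pD => + _; exact. Qed.

Lemma distr_cst c : \sum_v p v * c = c.
Proof. by rewrite -mulr_suml (proj2 pD) mul1r. Qed.

Lemma distr_addr (f : V -> R) c : \sum_v p v * (f v + c) = \sum_v p v * f v + c.
Proof.
by rewrite -{2}(distr_cst c) -big_split/=; apply: eq_bigr => v _; rewrite mulrDr.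
Qed.

Lemma distr_le (f g : V -> R) : (forall v, f v <= g v) ->
  \sum_v p v * f v <= \sum_v p v * g v.
Proof.
by move=> fg; apply: ler_sum => v _; rewrite ler_wpM2l// distr_ge0.
Qed.

Lemma distr_ge (f : V -> R) c : (forall v, c <= f v) -> c <= \sum_v p v * f v.
Proof. by move=> cf; rewrite -[leLHS]distr_cst; apply: distr_le. Qed.

Lemma distr_norm (f : V -> R) c : (forall v, `|f v| <= c) ->
  `|\sum_v p v * f v| <= c.
Proof.
move=> fc; rewrite ler_norml; apply/andP; split.
  by apply: distr_ge => v; have := fc v; rewrite ler_norml => /andP[].
rewrite -[leRHS]distr_cst; apply: distr_le => v.
by have := fc v; rewrite ler_norml => /andP[].
Qed.

End Distr.

(** * Means over histories and the drift inequality *)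

Definition is_kernel {R : realType} {T : nat} (M : mdp R T)
    (P : transition_kernel M) : Prop :=
  forall t (s : state M t) (a : action M t), (t < T)%N -> is_distr (P t s a).

Section Mean.
Context {R : realType} {T : nat} {M : mdp R T}.

Definition hist_mean (P : transition_kernel M) (pi : policy M) (s : state M 0)
    (t : nat) (G : hist M t -> R) : R :=
  \sum_(h : hist M t) hist_prob P pi s h * G h.

Lemma expect_total_costE (P : transition_kernel M) pi s g :
  expect_total_cost P pi s g = hist_mean P pi s
    (fun h : hist M T => \sum_a pi T h a * g (hist_cost h + cost (last_state h) a)).
Proof.
apply: eq_bigr => h _; rewrite mulr_sumr; apply: eq_bigr => a _.
by rewrite mulrA.
Qed.

Lemma hist_mean0 (P : transition_kernel M) pi s (G : hist M 0 -> R) :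
  hist_mean P pi s G = G s.
Proof.
rewrite /hist_mean (bigD1 s)//= eqxx mul1r big1 ?addr0// => h /negPf /= ->.
by rewrite mul0r.
Qed.

Lemma hist_meanS (P : transition_kernel M) pi s t (G : hist M t.+1 -> R) :
  hist_mean P pi s G = hist_mean P pi s (fun h : hist M t =>
    \sum_a pi t h a * \sum_s' P t (last_state h) a s' * G (h, a, s')).
Proof.
transitivity (\sum_(x : hist M t * action M t) \sum_s' hist_prob P pi s x.1 *
    pi t x.1 x.2 * P t (last_state x.1) x.2 s' * G (x, s')).
  by rewrite pair_bigA; apply: eq_bigr => -[[h a] s'].
transitivity (\sum_h \sum_a \sum_s' hist_prob P pi s h *
    pi t h a * P t (last_state h) a s' * G (h, a, s')).
  by rewrite [in RHS]pair_bigA; apply: eq_bigr => -[h a].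
apply: eq_bigr => h _; rewrite mulr_sumr; apply: eq_bigr => a _.
by rewrite mulrA mulr_sumr; apply: eq_bigr => s' _; rewrite !mulrA.
Qed.

Lemma hist_cost_itv t (h : hist M t) : (t <= T.+1)%N -> 0 <= hist_cost h <= t%:R.
Proof.
elim: t h => [h _|t ih h tT]/=; first by rewrite lexx.
have := ih h.1.1 (ltnW tT).
by have := cost_itv (last_state h.1.1) h.1.2 tT; rewrite -natr1; lra.
Qed.

Section Policy.
Context {P : transition_kernel M} { pi : policy M} {s : state M 0}.
Arguments P : clear implicits.
Arguments pi : clear implicits.
Hypotheses (PD : is_kernel P) (piD : policies pi).

Lemma hist_prob_ge0 t (h : hist M t) : (t <= T)%N -> 0 <= hist_prob P pi s h.
Proof.
elim: t h => [h _|t ih h tT]/=; first by rewrite ler0n.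
rewrite !mulr_ge0 ?ih ?(ltnW tT)// distr_ge0//; first exact/piD/ltnW.
exact: PD.
Qed.

Lemma hist_mean_cst t c : (t <= T)%N ->
  hist_mean P pi s (fun h : hist M t => c) = c.
Proof.
elim: t => [|t ih] tT; first by rewrite hist_mean0.
rewrite hist_meanS -[RHS]ih 1?ltnW//; apply: eq_bigr => h _; congr (_ * _).
rewrite (eq_bigr (fun a => pi t h a * c)) => [|a _]; last first.
  by rewrite (distr_cst (PD _ _ _)).
by rewrite (distr_cst (piD _ _))// ltnW.
Qed.

Lemma hist_mean_le t (G G' : hist M t -> R) : (t <= T)%N ->
  (forall h, G h <= G' h) -> hist_mean P pi s G <= hist_mean P pi s G'.
Proof.
by move=> tT GG; apply: ler_sum => h _; rewrite ler_wpM2l// hist_prob_ge0.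
Qed.

Lemma hist_mean_addr t (G : hist M t -> R) c : (t <= T)%N ->
  hist_mean P pi s (fun h => G h + c) = hist_mean P pi s G + c.
Proof.
move=> tT; rewrite -[in RHS](@hist_mean_cst t c)// /hist_mean -big_split/=.
by apply: eq_bigr => h _; rewrite mulrDr.
Qed.

(* G is a submartingale up to a drift sigma per stage. *)
Lemma drift_hist_mean (sigma : R) (G : forall t, hist M t -> R) :
  (forall t (h : hist M t), (t < T)%N -> G t h - sigma <=
     \sum_a pi t h a * \sum_s' P t (last_state h) a s' * G t.+1 (h, a, s')) ->
  forall t, (t <= T)%N -> G 0 s - t%:R * sigma <= hist_mean P pi s (G t).
Proof.
move=> drift; elim=> [_|t ih tT]; first by rewrite hist_mean0 mul0r subr0.
rewrite hist_meanS; have /= := hist_mean_le (ltnW tT) (fun h => drift t h tT).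
apply: le_trans; rewrite hist_mean_addr 1?ltnW//.
by rewrite -natr1 mulrDl mul1r opprD addrA lerD2r ih// ltnW.
Qed.

(** This is the interface to the comparisons below: [G] will be the optimal value, its negative, its
    image under [entropic], or a function of the first cost. Upper bounds come from reversing the
    sign of [g] or of [kappa]. *)
Lemma drift_expect (sigma : R) (G : forall t, hist M t -> R) (g : R -> R) :
  (forall t (h : hist M t), (t < T)%N -> G t h - sigma <=
     \sum_a pi t h a * \sum_s' P t (last_state h) a s' * G t.+1 (h, a, s')) ->
  (forall h : hist M T, G T h <=
     \sum_a pi T h a * g (hist_cost h + cost (last_state h) a)) ->
  G 0 s - T%:R * sigma <= expect_total_cost P pi s g.
Proof.
move=> drift Gg; rewrite expect_total_costE.
by apply: le_trans (drift_hist_mean drift (leqnn T)) _; exact: hist_mean_le.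
Qed.

Lemma expect_total_cost_lb (g : R -> R) c :
  (forall z, 0 <= z <= T%:R + 1 -> c <= g z) -> c <= expect_total_cost P pi s g.
Proof.
move=> cg; rewrite expect_total_costE -[leLHS](@hist_mean_cst T c)//.
apply: hist_mean_le => // h; apply: (distr_ge (piD h (leqnn T))) => a; apply: cg.
have := hist_cost_itv h (leqnSn T); have := cost_itv (last_state h) a (leqnn T); lra.
Qed.

Lemma expect_total_cost_le (g g' : R -> R) :
  (forall z, 0 <= z <= T%:R + 1 -> g z <= g' z) ->
  expect_total_cost P pi s g <= expect_total_cost P pi s g'.
Proof.
move=> gg; rewrite !expect_total_costE; apply: hist_mean_le => // h.
apply: (distr_le (piD h (leqnn T))) => a; apply: gg.
have := hist_cost_itv h (leqnSn T); have := cost_itv (last_state h) a (leqnn T); lra.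
Qed.

Lemma expect_total_cost_addr (g : R -> R) c :
  expect_total_cost P pi s (fun z => g z + c) = expect_total_cost P pi s g + c.
Proof.
rewrite !expect_total_costE -hist_mean_addr//; apply: eq_bigr => h _.
by rewrite (distr_addr (piD h (leqnn T))).
Qed.

Lemma expect_total_cost_scale (g : R -> R) c :
  expect_total_cost P pi s (fun z => c * g z) = c * expect_total_cost P pi s g.
Proof.
rewrite mulr_sumr; apply: eq_bigr => h _; rewrite mulr_sumr.
by apply: eq_bigr => a _; rewrite mulrCA.
Qed.

End Policy.

End Mean.

(** * Elementary bounds for -ln (1 - kappa v) *)

Section EntropicUtility.
Context {R : realType}.
Implicit Types kappa x y v : R.

Lemma ln_lip (x y : R) : 1 / 2 <= x -> 1 / 2 <= y -> `|ln x - ln y| <= 2 * `|x - y|.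
Proof.
wlog yx : x y / y <= x => [hw|] hx hy.
  have [/hw->//|/ltW/hw] := leP y x.
  by rewrite distrC [`|x - y|]distrC; apply.
have y0 : 0 < y by lra.
have x0 : 0 < x by lra.
rewrite ger0_norm ?subr_ge0 ?ler_ln// ger0_norm ?subr_ge0//.
rewrite -ln_div//; have -> : x / y = 1 + (x - y) / y by field; rewrite gt_eqF.
have h : (x - y) / y <= 2 * (x - y).
  by rewrite ler_pdivrMr//; have : 0 <= x - y; nra.
apply: le_trans h; apply: le_ln1Dx.
by rewrite (lt_le_trans (_ : _ < 0))// divr_ge0 ?subr_ge0// ltW.
Qed.

(* exp (- entropic kappa v) is affine in v, so that the moment generating
   functions in the Chernoff bound are computed exactly. *)
Definition entropic (kappa v : R) : R := - ln (1 - kappa * v).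

Lemma entropic_arg kappa v : `|kappa| <= 1 / 2 -> `|v| <= 1 ->
  1 / 2 <= 1 - kappa * v.
Proof.
move=> hk hv; have : kappa * v <= 1 / 2; last lra.
by rewrite (le_trans (ler_norm _))// normrM -[leRHS]mulr1 ler_pM.
Qed.

Lemma entropic_ge kappa v : `|kappa| <= 1 / 2 -> `|v| <= 1 ->
  kappa * v <= entropic kappa v.
Proof.
move=> hk hv; rewrite /entropic lerNr; apply: le_ln1Dx.
by have := entropic_arg hk hv; lra.
Qed.

(** With x = kappa v, -ln (1 - x) = ln (1 + x / (1 - x)) <= x / (1 - x), which is at most x + 2 x^2
    for x <= 1/2. *)
Lemma entropic_le kappa v : `|kappa| <= 1 / 2 -> `|v| <= 1 ->
  entropic kappa v <= kappa * v + 2 * kappa ^+ 2.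
Proof.
move=> hk hv; have h := entropic_arg hk hv; rewrite /entropic.
set x := kappa * v in h *; have x0 : 0 < 1 - x by lra.
rewrite -lnV//; have -> : (1 - x)^-1 = 1 + x / (1 - x) by field; rewrite gt_eqF.
have hx : x ^+ 2 <= kappa ^+ 2.
  rewrite exprMn ler_piMr ?sqr_ge0//.
  by rewrite -real_normK ?num_real// exprn_ile1.
have hx' : x / (1 - x) <= x + 2 * x ^+ 2.
  rewrite ler_pdivrMr// -subr_ge0.
  have -> : (x + 2 * x ^+ 2) * (1 - x) - x = x ^+ 2 * (1 - 2 * x) by ring.
  by rewrite mulr_ge0 ?sqr_ge0//; lra.
apply: (@le_trans _ _ (x / (1 - x))); last lra.
apply: le_ln1Dx; rewrite -subr_gt0.
have -> : x / (1 - x) - -1 = (1 - x)^-1 by field; rewrite gt_eqF.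
by rewrite invr_gt0.
Qed.

Lemma entropic_mono kappa v v' : `|kappa| <= 1 / 2 -> `|v| <= 1 -> `|v'| <= 1 ->
  kappa * v <= kappa * v' -> entropic kappa v <= entropic kappa v'.
Proof.
move=> hk hv hv' vv; rewrite /entropic lerN2 ler_ln ?posrE ?lerD2l ?lerN2//.
  by have := entropic_arg hk hv'; lra.
by have := entropic_arg hk hv; lra.
Qed.

Lemma entropic_lip kappa v v' : `|kappa| <= 1 / 2 -> `|v| <= 1 -> `|v'| <= 1 ->
  `|entropic kappa v - entropic kappa v'| <= 2 * `|kappa| * `|v - v'|.
Proof.
move=> hk hv hv'; rewrite /entropic opprK addrC -mulrA -normrM.
have -> : kappa * (v - v') = (1 - kappa * v') - (1 - kappa * v) by ring.
by apply: ln_lip; apply: entropic_arg.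
Qed.

End EntropicUtility.

(** * Dynamic programming in the state and the accumulated cost *)

Section BestAction.
Context {R : realType} {T : nat} {M : mdp R T}.

Definition best_action t (F : action M t -> R) : action M t :=
  [arg min_(a < enum_val (Ordinal (action_gt0 M t))) F a]%O.

Lemma best_action_le t (F : action M t -> R) a : F (best_action F) <= F a.
Proof. by rewrite /best_action; case: arg_minP => // i _ /(_ a); apply. Qed.

End BestAction.

Section DynamicProgramming.
Context {R : realType} {T : nat} {M : mdp R T}.
Variables (P : transition_kernel M) (u : R -> R).
Arguments P : clear implicits.

(* The optimal expectation of u (total cost) when action a is played in
   state s with k stages left after the current one and accumulated cost y. *)
Fixpoint action_value (k t : nat) (s : state M t) (y : R) (a : action M t) : R :=
  match k with
  | 0 => u (y + cost s a)
  | k'.+1 => \sum_s' P t s a s' *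
      action_value k' s' (y + cost s a)
        (best_action (action_value k' s' (y + cost s a)))
  end.

Definition value k t (s : state M t) y : R :=
  action_value k s y (best_action (action_value k s y)).

Lemma value_le k t (s : state M t) y a : value k s y <= action_value k s y a.
Proof. exact: best_action_le. Qed.

Definition greedy : policy M := fun t h a =>
  (a == best_action (action_value (T - t) (last_state h) (hist_cost h)))%:R.

Lemma greedy_sum t (h : hist M t) (F : action M t -> R) :
  \sum_a greedy h a * F a =
  F (best_action (action_value (T - t) (last_state h) (hist_cost h))).
Proof.
rewrite /greedy; set b := best_action _; rewrite (bigD1 b)//= eqxx mul1r.
by rewrite big1 ?addr0// => a /negPf ->; rewrite mul0r.
Qed.

Lemma greedy_policy : policies greedy.
Proof.
move=> t h _; split=> [a|]; first by rewrite /greedy ler0n.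
by rewrite -[RHS](greedy_sum h (fun=> 1)); apply: eq_bigr => a _; rewrite mulr1.
Qed.

Hypothesis PD : is_kernel P.

Lemma value_norm k t (s : state M t) y : (forall z, `|u z| <= 1) ->
  (t + k <= T)%N -> `|value k s y| <= 1.
Proof.
move=> u1; rewrite /value; move: (best_action _) => a.
elim: k t s y a => [|k ih] t s y a /= tk; first exact: u1.
have tk' : (t.+1 + k <= T)%N by rewrite addSnnS.
have tT := leq_trans (leq_addr k t.+1) tk'.
by apply: (distr_norm (PD s a tT)) => s'; exact: ih.
Qed.

(** The best action at [y'] is also tried at [y]; the one-sided estimate this gives passes through
    the averages with the same constant. *)
Lemma action_value_lip lam k t (s : state M t) y y' a :
  (forall z z', u z - u z' <= lam * `|z - z'|) -> (t + k <= T)%N ->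
  action_value k s y a - action_value k s y' a <= lam * `|y - y'|.
Proof.
move=> ul; elim: k t s y y' a => [|k ih] t s y y' a /= tk.
  by apply: le_trans (ul _ _) _; rewrite opprD addrACA subrr addr0.
have tk' : (t.+1 + k <= T)%N by rewrite addSnnS.
have tT := leq_trans (leq_addr k t.+1) tk'.
rewrite -sumrB (eq_bigr _ (fun i _ => esym (mulrBr _ _ _))).
rewrite -[leRHS](distr_cst (PD s a tT)); apply: (distr_le (PD s a tT)) => s'.
set a' := best_action (action_value k s' (y' + _)).
have := value_le k s' (y + cost s a) a'; rewrite /value => le1.
have := ih _ s' (y + cost s a) (y' + cost s a) a' tk'.
by rewrite opprD addrACA subrr addr0; lra.
Qed.

Lemma value_lip lam k t (s : state M t) y y' :
  (forall z z', u z - u z' <= lam * `|z - z'|) -> (t + k <= T)%N ->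
  `|value k s y - value k s y'| <= lam * `|y - y'|.
Proof.
move=> ul tk; wlog vv : y y' / value k s y' <= value k s y => [hw|].
  have [/hw//|/ltW/hw] := leP (value k s y') (value k s y).
  by rewrite distrC [`|y - y'|]distrC.
rewrite ger0_norm ?subr_ge0//.
have := value_le k s y (best_action (action_value k s y')).
have := action_value_lip s y y' (best_action (action_value k s y')) ul tk.
by rewrite -/(value k s y'); lra.
Qed.

Lemma action_valueS t (s : state M t) y a : (t < T)%N ->
  action_value (T - t) s y a =
  \sum_s' P t s a s' * value (T - t.+1) s' (y + cost s a).
Proof. by move=> tT; rewrite -(subnSK tT). Qed.

(** The optimal value along the history is a submartingale under every policy; history dependence
    brings no gain because the bound holds action by action. *)
Lemma value_expect_le pi s : policies pi ->
  value T s 0 <= expect_total_cost P pi s u.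
Proof.
move=> piD; pose G t (h : hist M t) := value (T - t) (last_state h) (hist_cost h).
have -> : value T s 0 = G 0 s - T%:R * 0 by rewrite mulr0 subr0 /G subn0.
apply: drift_expect => // [t h tT|h].
  rewrite subr0; apply: (distr_ge (piD _ h (ltnW tT))) => a.
  by rewrite (le_trans (value_le _ _ _ a))// action_valueS.
apply: (distr_ge (piD _ h (leqnn T))) => a.
by rewrite (le_trans (value_le _ _ _ a))// subnn.
Qed.

(** Under [greedy] the value process is a martingale, so the drift inequality also applies to its
    negative. *)
Lemma expect_greedy_le s : expect_total_cost P greedy s u <= value T s 0.
Proof.
pose G t (h : hist M t) := - value (T - t) (last_state h) (hist_cost h).
rewrite -lerN2 -[leRHS]mulN1r -expect_total_cost_scale.
have -> : - value T s 0 = G 0 s - T%:R * 0 by rewrite mulr0 subr0 /G subn0.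
apply: drift_expect => // [|t h tT|h]; first exact: greedy_policy.
  rewrite subr0 greedy_sum /G {1}/value action_valueS//= -sumrN.
  by apply: ler_sum => s' _; rewrite mulrN.
by rewrite greedy_sum /G mulN1r {1}/value subnn.
Qed.

End DynamicProgramming.

(** * Transfer of optimal values from [P] to a calibrated kernel [Q] *)

Section Comparison.
Context {R : realType} {T : nat} {M : mdp R T}.
Variables (P Q : transition_kernel M) (u : R -> R) (lam eta beta kappa : R).
Variable K : nat.
Arguments P : clear implicits.
Arguments Q : clear implicits.

(** In the application [Q] is the empirical kernel and [beta] is l / n. Only finitely many
    accumulated costs occur, so that a union bound can ensure it. *)
Definition grid_calibrated (kappa : R) : Prop :=
  forall t (s : state M t) (a : action M t) (i : 'I_K.+1), (t < T)%N ->
  entropic kappa (\sum_s' P t s a s' * value P u (T - t.+1) s' (i%:R * eta)) - beta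
  <= \sum_s' Q t s a s' * entropic kappa (value P u (T - t.+1) s' (i%:R * eta)).

Hypotheses (PD : is_kernel P) (QD : is_kernel Q).
Hypotheses (u1 : forall z, `|u z| <= 1)
  (ul : forall z z', u z - u z' <= lam * `|z - z'|).
Hypotheses (lam0 : 0 <= lam) (eta0 : 0 < eta) (etaK : T%:R <= K%:R * eta).

Let sigma := beta + 4 * `|kappa| * lam * eta.

(** Rounding [y] down to the grid moves each value by at most [lam * eta], hence each side by at
    most [2 * |kappa| * lam * eta]; [sigma] collects both errors. *)
Lemma grid_calibrated_all t (s : state M t) (a : action M t) (y : R) :
  `|kappa| <= 1 / 2 ->
  grid_calibrated kappa -> (t < T)%N -> 0 <= y <= T%:R ->
  entropic kappa (\sum_s' P t s a s' * value P u (T - t.+1) s' y) - sigma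
  <= \sum_s' Q t s a s' * entropic kappa (value P u (T - t.+1) s' y).
Proof.
move=> kap2 cal tT /andP[y0 yT].
have tk : (t.+1 + (T - t.+1) <= T)%N by rewrite subnKC.
have V1 s' z := value_norm PD s' z u1 tk.
have V2 z := distr_norm (PD s a tT) (fun s' => V1 s' z).
have yeta0 : 0 <= y / eta by rewrite divr_ge0// ltW.
have [i0 i1] : (Num.truncn (y / eta))%:R <= y / eta /\
    y / eta < (Num.truncn (y / eta)).+1%:R.
  by have /andP[] := truncn_itv yeta0.
have iK : (Num.truncn (y / eta) < K.+1)%N.
  rewrite ltnS -(ler_nat R) (le_trans i0)// ler_pdivrMr//.
  exact: le_trans yT etaK.
set i := Ordinal iK; pose yi := i%:R * eta.
have yy : `|y - yi| <= eta.
  rewrite ger0_norm; last by rewrite subr_ge0 /yi -ler_pdivlMr.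
  by move: i1; rewrite ltr_pdivrMr// -natr1 /yi/=; lra.
have lip (s' : state M t.+1) :
    `|value P u (T - t.+1) s' y - value P u (T - t.+1) s' yi| <= lam * eta.
  by apply: le_trans (value_lip PD s' y yi ul tk) _; rewrite ler_wpM2l.
have := cal t s a i tT; rewrite -/yi => h.
have h1 : entropic kappa (\sum_s' P t s a s' * value P u (T - t.+1) s' y)
    - entropic kappa (\sum_s' P t s a s' * value P u (T - t.+1) s' yi)
    <= 2 * `|kappa| * (lam * eta).
  apply: le_trans (ler_norm _) _; apply: le_trans (entropic_lip _ _ _) _ => //.
  rewrite ler_wpM2l// ?mulr_ge0// -sumrB.
  rewrite (eq_bigr _ (fun i _ => esym (mulrBr _ _ _))).
  exact: (distr_norm (PD s a tT)).
have h2 : \sum_s' Q t s a s' * entropic kappa (value P u (T - t.+1) s' yi)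
    - 2 * `|kappa| * (lam * eta)
    <= \sum_s' Q t s a s' * entropic kappa (value P u (T - t.+1) s' y).
  rewrite -(distr_addr (QD s a tT)); apply: (distr_le (QD s a tT)) => s'.
  rewrite lerBlDr -lerBlDl; apply: le_trans (ler_norm _) _.
  rewrite distrC; apply: le_trans (entropic_lip _ _ _) _ => //.
  by rewrite ler_wpM2l ?mulr_ge0.
by rewrite /sigma; lra.
Qed.

(** For positive [kappa], [entropic] is increasing, so the Bellman inequality for an arbitrary
    action passes through it and every policy is covered. Linearizing [entropic] at the last stage
    and dividing by [kappa] costs [2 * kappa]. *)
Lemma value_le_expect pi s : 0 < kappa <= 1 / 2 -> grid_calibrated kappa ->
  policies pi ->
  value P u T s 0 <=
  expect_total_cost Q pi s u + 2 * kappa + T%:R * sigma / kappa.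
Proof.
move=> /andP[k0 k2] cal piD; have kn : `|kappa| <= 1 / 2 by rewrite gtr0_norm.
pose G t (h : hist M t) :=
  entropic kappa (value P u (T - t) (last_state h) (hist_cost h)).
have V1 t (h : hist M t) : (t <= T)%N ->
    `|value P u (T - t) (last_state h) (hist_cost h)| <= 1.
  by move=> tT; apply: value_norm => //; rewrite subnKC.
have : G 0 s - T%:R * sigma <=
    expect_total_cost Q pi s (fun z => entropic kappa (u z)).
  apply: drift_expect => // [t h tT|h].
    apply: (distr_ge (piD _ h (ltnW tT))) => a.
    have hc : 0 <= hist_cost h + cost (last_state h) a <= T%:R.
      have := hist_cost_itv h (leqW (ltnW tT)).
      have := cost_itv (last_state h) a (ltnW tT).
      have : t.+1%:R <= T%:R :> R by rewrite ler_nat.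
      by rewrite -natr1; lra.
    apply: le_trans (grid_calibrated_all (last_state h) a kn cal tT hc).
    rewrite lerD2r; apply: entropic_mono => //; first exact/V1/ltnW.
      apply: (distr_norm (PD (last_state h) a tT)) => s'.
      by apply: value_norm => //; rewrite subnKC.
    rewrite ler_wpM2l ?(ltW k0)//.
    by apply: le_trans (value_le _ _ _ _ _ a) _; rewrite action_valueS.
  apply: (distr_ge (piD _ h (leqnn T))) => a.
  apply: entropic_mono => //; first exact: V1.
  rewrite ler_wpM2l ?(ltW k0)//.
  by apply: le_trans (value_le _ _ _ _ _ a) _; rewrite subnn.
have hs : `|value P u T s 0| <= 1 by have := V1 0 s (leq0n T); rewrite subn0.
move=> h2; have := entropic_ge kn hs => h1.
have h3 : expect_total_cost Q pi s (fun z => entropic kappa (u z)) <=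
    kappa * expect_total_cost Q pi s u + 2 * kappa ^+ 2.
  rewrite -expect_total_cost_scale -expect_total_cost_addr//.
  by apply: expect_total_cost_le => // z _; exact: entropic_le.
have e : kappa * (T%:R * sigma / kappa) = T%:R * sigma.
  by rewrite mulrC divfK ?gt_eqF.
move: h2 e; rewrite /G subn0/= -(ler_pM2l k0 (value P u T s 0));
set w := T%:R * sigma / kappa => h2 e.
by move: h1 h3 h2 e; lra.
Qed.

(** For negative [kappa], [entropic] is decreasing and reverses the Bellman inequality; the greedy
    action is followed because for it the inequality is an equality. *)
Lemma expect_greedy_le_value s :
  0 < - kappa <= 1 / 2 -> grid_calibrated kappa ->
  expect_total_cost Q (greedy P u) s u <=
  value P u T s 0 + 2 * (- kappa) + T%:R * sigma / - kappa.
Proof.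
move=> /andP[k0 k2] cal; have kn : `|kappa| <= 1 / 2.
  by rewrite ltr0_norm// -oppr_gt0.
have piD := greedy_policy P u.
pose G t (h : hist M t) :=
  entropic kappa (value P u (T - t) (last_state h) (hist_cost h)).
have : G 0 s - T%:R * sigma <=
    expect_total_cost Q (greedy P u) s (fun z => entropic kappa (u z)).
  apply: drift_expect => // [t h tT|h]; rewrite greedy_sum; last first.
    by rewrite /G /value subnn.
  set a := best_action _.
  have hc : 0 <= hist_cost h + cost (last_state h) a <= T%:R.
    have := hist_cost_itv h (leqW (ltnW tT)).
    have := cost_itv (last_state h) a (ltnW tT).
    have : t.+1%:R <= T%:R :> R by rewrite ler_nat.
    by rewrite -natr1; lra.
  apply: le_trans (grid_calibrated_all (last_state h) a kn cal tT hc).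
  by rewrite lerD2r -action_valueS.
have hs : `|value P u T s 0| <= 1 by exact: value_norm.
move=> h2; have h1 := entropic_ge kn hs.
have h3 : expect_total_cost Q (greedy P u) s (fun z => entropic kappa (u z)) <=
    kappa * expect_total_cost Q (greedy P u) s u + 2 * kappa ^+ 2.
  rewrite -expect_total_cost_scale -expect_total_cost_addr//.
  by apply: expect_total_cost_le => // z _; exact: entropic_le.
have e : - kappa * (T%:R * sigma / - kappa) = T%:R * sigma.
  by rewrite mulrC divfK ?gt_eqF.
move: h2 e; rewrite /G subn0/= -(ler_pM2l k0 (expect_total_cost Q _ s u));
set w := T%:R * sigma / - kappa => h2 e.
by move: h1 h3 h2 e; lra.
Qed.

End Comparison.

(** * A Chernoff bound for product distributions *)

Section Chernoff.
Context {R : realType}.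

(** Markov's inequality for the product of the g (x_i), whose mean is m^n: on the event summed over,
    this product exceeds m^n exp l. *)
Lemma chernoff_product (V : finType) (n : nat) (p g : V -> R) (l : R) :
  is_distr p -> (forall v, 0 < g v) ->
  \sum_(x : {ffun 'I_n -> V} |
      n%:R * ln (\sum_v p v * g v) + l < \sum_i ln (g (x i))) \prod_i p (x i)
  <= expR (- l).
Proof.
move=> pD g0; set m := \sum_v _.
have pg v : 0 <= p v * g v by rewrite mulr_ge0 ?(distr_ge0 pD) ?ltW.
have m0 : 0 < m.
  rewrite lt_neqAle sumr_ge0 ?andbT//.
  apply/eqP => /esym/eqP; rewrite psumr_eq0 => [/allP m0|//].
  have : \sum_v p v = 0.
    apply: big1 => v _; have := m0 v (mem_index_enum _).
    by rewrite mulf_eq0 (gt_eqF (g0 v)) orbF => /eqP.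
  by rewrite (proj2 pD) => /eqP; rewrite oner_eq0.
(* The bound is written as the full mean of the product divided by m^n exp l, so that the sums
   compare term by term. *)
have -> : expR (- l) = \sum_(x : {ffun 'I_n -> V})
    \prod_i (p (x i) * g (x i)) / (m ^+ n * expR l).
  rewrite -mulr_suml -(bigA_distr_bigA (fun (_ : 'I_n) v => p v * g v)) /=.
  rewrite prodr_const card_ord invfM mulrA divff ?expf_neq0 ?gt_eqF//.
  by rewrite mul1r expRN.
have ml0 : 0 < m ^+ n * expR l by rewrite mulr_gt0 ?exprn_gt0 ?expR_gt0.
have pg0 x : 0 <= \prod_(i < n) (p (x i) * g (x i)) / (m ^+ n * expR l).
  by rewrite divr_ge0 ?(ltW ml0)// prodr_ge0.
rewrite [leRHS](bigID (fun x : {ffun 'I_n -> V} =>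
  n%:R * ln m + l < \sum_i ln (g (x i))))/= -[leLHS]addr0 lerD ?sumr_ge0//.
apply: ler_sum => x xbad; rewrite big_split/= -mulrA ler_peMr//.
  by apply: prodr_ge0 => i _; exact: (distr_ge0 pD).
rewrite ler_pdivlMr// mul1r -[m in leLHS]lnK ?posrE// -expRM_natl -expRD.
have -> : \prod_(i < n) g (x i) = expR (\sum_i ln (g (x i))).
  by rewrite expR_sum; apply: eq_bigr => i _; rewrite lnK ?posrE.
by rewrite ler_expR ltW.
Qed.

End Chernoff.

(** * Finite unions and intersections of events *)

Section FiniteUnion.
Context {d : measure_display} {Omega : measurableType d} {R : realType}.

Lemma measure_bigsetU_le (mu : {measure set Omega -> \bar R}) (I : Type)
    (r : seq I) (D : pred I) (F : I -> set Omega) :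
  (forall i, measurable (F i)) ->
  (mu (\big[setU/set0]_(i <- r | D i) F i) <= \sum_(i <- r | D i) mu (F i))%E.
Proof.
move=> mF; elim: r => [|i r ih]; first by rewrite !big_nil measure0.
rewrite !big_cons; case: ifP => // _.
apply: le_trans (measureU2 _ _ _) _ => //; first exact: bigsetU_measurable.
exact: leeD2l.
Qed.

Lemma bigcup_finType (I : finType) (D : pred I) (F : I -> set Omega) :
  \bigcup_(i in [set i | D i]) F i = \big[setU/set0]_(i | D i) F i.
Proof.
rewrite -bigcup_seq_cond; apply/seteqP; split => w [i /= Di Fi]; exists i => //=.
  by rewrite mem_index_enum.
by case/andP: Di.
Qed.

Lemma measurable_bigcup_finType (I : finType) (D : set I) (F : I -> set Omega) :
  (forall i, measurable (F i)) -> measurable (\bigcup_(i in D) F i).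
Proof. by move=> mF; apply: fin_bigcup_measurable => //; exact: finite_finset. Qed.

Lemma measurable_bigcap_finType (I : finType) (D : set I) (F : I -> set Omega) :
  (forall i, measurable (F i)) -> measurable (\bigcap_(i in D) F i).
Proof. by move=> mF; apply: fin_bigcap_measurable => //; exact: finite_finset. Qed.

End FiniteUnion.

(** * The empirical kernel and its deviation events *)

Section Empirical.
Context {R : realType} {T : nat} {M : mdp R T} {n : nat}.
Context {d : measure_display} {Omega : measurableType d}.
Variable X : @samples R T M n d Omega.
Arguments X : clear implicits.

Lemma empirical_sum w t (s : state M t) (a : action M t) (phi : state M t.+1 -> R) :
  \sum_s' empirical_kernel X w s a s' * phi s' =
  (\sum_i phi (X t s a i w)) / n%:R.
Proof.
rewrite /empirical_kernel; under eq_bigr do rewrite mulrAC.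
rewrite -mulr_suml; congr (_ / _); under eq_bigr do rewrite mulr_suml.
rewrite exchange_big/=.
apply: eq_bigr => i _; rewrite (bigD1 (X t s a i w))//= eqxx mul1r.
by rewrite big1 ?addr0// => s' /negPf; rewrite eq_sym => ->; rewrite mul0r.
Qed.

Lemma empirical_distr w t (s : state M t) (a : action M t) : (0 < n)%N ->
  is_distr (empirical_kernel X w s a).
Proof.
move=> n0; split=> [s'|]; first by rewrite divr_ge0 ?sumr_ge0.
have := empirical_sum w s a (fun=> 1).
under eq_bigr do rewrite mulr1.
by move=> ->; rewrite sumr_const card_ord divff// pnatr_eq0 -lt0n.
Qed.

Context {Pr : probability Omega R}.
Hypothesis iid : iid_samples Pr X.

(** The samples take finitely many joint values, so an event determined by them is a finite union of
    measurable cylinders. This covers events about [opt_risk] without an analysis of the infima. *)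
Lemma determined_measurable (E : set Omega) :
  (forall w w', (forall t s a i, (t < T)%N -> X t s a i w = X t s a i w') ->
    E w -> E w') ->
  measurable E.
Proof.
move=> Einv.
(* Tagging puts the samples of all stages into one finite type, so that joint outcomes are ordinary
   finite functions. *)
pose Z (j : sample_index M n) w : {t : 'I_T & state M t.+1} :=
  Tagged (fun t : 'I_T => state M t.+1) (sample_at X j w).
have mZ j z : measurable [set w | Z j w = z].
  have [[w0 /= w0z]|nz] := pselect (exists w, Z j w = z); last first.
    rewrite (_ : [set w | _] = set0)//; apply/seteqP; split => w //= wz.
    by apply: nz; exists w.
  have -> : [set w | Z j w = z] = [set w | sample_at X j w = sample_at X j w0].
    apply/seteqP; split => w /=; rewrite -w0z.
      by move/eqP; rewrite eq_Tagged => /eqP.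
    by rewrite /Z => ->.
  case: iid => mX _ _; case: j {Z w0z z} => -[t tT] [[s a] i] /=.
  exact: mX.
have -> : E = \bigcup_(z in [set z : {ffun sample_index M n -> {t : 'I_T & state M t.+1}} |
    exists2 w, E w & forall j, Z j w = z j])
    \bigcap_(j in [set: sample_index M n]) [set w | Z j w = z j].
  apply/seteqP; split => w.
    by move=> Ew; exists [ffun j => Z j w] => [|j _]/=; [exists w => // j|]; rewrite ffunE.
  move=> [z /= [w' Ew' zw'] zw]; apply: Einv Ew' => t s a i tT.
  pose j : sample_index M n := Tagged (fun t : 'I_T =>
    (state M t * action M t * 'I_n)%type) (i := Ordinal tT) (s, a, i).
  have /eqP : Z j w' = Z j w by rewrite zw' zw.
  by rewrite eq_Tagged => /eqP.
apply: measurable_bigcup_finType => z; exact: measurable_bigcap_finType.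
Qed.

(** Independence is applied to the n indices of one triple (t, s, a), with singletons as target
    sets. *)
Lemma samples_joint t (s : state M t) (a : action M t) (x : {ffun 'I_n -> state M t.+1}) :
  (t < T)%N ->
  Pr [set w | forall i, X t s a i w = x i] = (\prod_i trans s a (x i))%:E.
Proof.
move=> tT; have [mX lawX indX] := iid.
pose j i : sample_index M n := Tagged (fun t : 'I_T =>
    (state M t * action M t * 'I_n)%type) (i := Ordinal tT) (s, a, i).
have jinj : injective j.
  by move=> i i' /eqP; rewrite eq_Tagged => /eqP [].
(* Targets must be given at every index, whatever its stage; comparing tagged values avoids a
   cast. *)
pose B (k : sample_index M n) : {set state M (tag k).+1} := finset (fun v =>
   Tagged (fun t : 'I_T => state M t.+1) v ==
   Tagged (fun t : 'I_T => state M t.+1) (i := Ordinal tT) (x (tagged k).2)).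
have Bj i : [set w | sample_at X (j i) w \in B (j i)] = [set w | X t s a i w = x i].
  apply/seteqP; split => w /=; rewrite inE eq_Tagged => /eqP//.
have := indX [set j i | i : 'I_n]%SET B.
rewrite big_imset => /=; last by move=> i i' _ _; exact: jinj.
have -> : [set w | forall k, k \in [set j i | i : 'I_n]%SET ->
    sample_at X k w \in B k] = [set w | forall i, X t s a i w = x i].
  apply/seteqP; split => w /= h => [i|k /imsetP[i _ ->]].
    by have : [set w | sample_at X (j i) w \in B (j i)] w
      by [apply: h; rewrite imset_f]; rewrite Bj.
  have : [set w | X t s a i w = x i] w by exact: h.
  by rewrite -Bj.
under eq_bigr do rewrite Bj lawX//=.
move=> <-; rewrite fineK// fin_num_measure//.
rewrite (_ : [set w | _] = \bigcap_(i in [set: 'I_n]) [set w | X t s a i w = x i]).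
  by apply: measurable_bigcap_finType => i; exact: mX.
by apply/seteqP; split => w /= h i; [move=> _; exact: h|exact: h _ I].
Qed.

(** For g = 1 - kappa v this is the failure, with tolerance l / n, of the one-step inequality for
    [entropic]. *)
Definition deviation t (s : state M t) (a : action M t) (g : state M t.+1 -> R)
    (l : R) : set Omega :=
  [set w | n%:R * ln (\sum_s' trans s a s' * g s') + l < \sum_i ln (g (X t s a i w))].

Lemma deviation_measurable t (s : state M t) (a : action M t) g l : (t < T)%N ->
  measurable (deviation s a g l).
Proof.
move=> tT; apply: determined_measurable => w w' ww'.
rewrite /deviation/= => /lt_le_trans; apply; rewrite le_eqVlt; apply/orP; left.
by apply/eqP/eq_bigr => i _; rewrite ww'.
Qed.

Lemma deviation_le t (s : state M t) (a : action M t) g l : (t < T)%N ->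
  (forall s', 0 < g s') ->
  (Pr (deviation s a g l) <= (expR (- l))%:E)%E.
Proof.
move=> tT g0.
have mx (x : {ffun 'I_n -> state M t.+1}) : measurable [set w | forall i, X t s a i w = x i].
  apply: determined_measurable => w w' ww' h i; rewrite -ww'//; exact: h.
have -> : deviation s a g l = \bigcup_(x in
    [set x : {ffun 'I_n -> state M t.+1} |
      n%:R * ln (\sum_s' trans s a s' * g s') + l < \sum_i ln (g (x i))])
    [set w | forall i, X t s a i w = x i].
  apply/seteqP; split => w.
    rewrite /deviation/= => h; exists [ffun i => X t s a i w] => [|i]/=; last by rewrite ffunE.
    by rewrite (eq_bigr (fun i => ln (g (X t s a i w)))) => // i _; rewrite ffunE.
  move=> [x /= h xw]; rewrite /deviation/=.
  by rewrite (eq_bigr (fun i => ln (g (x i)))) => // i _; rewrite xw.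
rewrite bigcup_finType; apply: le_trans (measure_bigsetU_le _ _ _ _) _ => //.
rewrite (eq_bigr _ (fun x _ => samples_joint s a x tT)).
by rewrite sumEFin lee_fin chernoff_product//; exact: trans_distr.
Qed.

(** As [1 - kappa * v] is affine in [v], its mean is its value at the mean of [v]; dividing by -n
    yields [entropic]. *)
Lemma not_deviation w t (s : state M t) (a : action M t) (v : state M t.+1 -> R)
    (kappa l : R) : (0 < n)%N -> (t < T)%N ->
  ~ deviation s a (fun s' => 1 - kappa * v s') l w ->
  entropic kappa (\sum_s' trans s a s' * v s') - l / n%:R <=
  \sum_s' empirical_kernel X w s a s' * entropic kappa (v s').
Proof.
move=> n0 tT /negP; rewrite -leNgt empirical_sum /entropic.
have n0' : 0 < n%:R :> R by rewrite ltr0n.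
have -> : \sum_s' trans s a s' * (1 - kappa * v s') =
    1 - kappa * \sum_s' trans s a s' * v s'.
  under eq_bigr do rewrite addrC; rewrite distr_addr; last exact: trans_distr.
  rewrite addrC mulr_sumr -sumrN; congr (_ + _).
  by apply: eq_bigr => s' _; rewrite mulrN mulrCA.
rewrite sumrN ler_pdivlMr// mulrBl divfK ?gt_eqF//; lra.
Qed.

End Empirical.

(** * Finite nets of bounded Euclidean sets *)

Section EuclideanCover.
Context {R : realType}.

Lemma geometric_sum_le (q : R) n : 0 <= q < 1 -> \sum_(i < n) q ^+ i <= (1 - q)^-1.
Proof.
move=> /andP[q0 q1]; have q10 : 0 < 1 - q by rewrite subr_gt0.
rewrite -(ler_pM2l q10) mulfV ?gt_eqF//.
have -> : (1 - q) * \sum_(i < n) q ^+ i = 1 - q ^+ n.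
  by apply: oppr_inj; rewrite -mulNr !opprB -subrX1.
by rewrite gerBl exprn_ge0.
Qed.

Lemma expR1_le4 : expR 1 <= 4 :> R.
Proof.
have e2 : expR (1 / 2) <= 2 :> R.
  have := expR_ge1Dx (- (1 / 2) : R); rewrite expRN => h.
  rewrite -(invrK (expR _)) -[leRHS]invrK lef_pV2 ?posrE ?invr_gt0 ?expR_gt0//.
  lra.
rewrite [X in expR X](_ : 1 = 2%:R * (1 / 2)); last lra.
rewrite expRM_natl [leRHS](_ : 4 = 2 ^+ 2); last by rewrite expr2; lra.
by rewrite ler_pXn2r ?nnegrE ?expR_ge0.
Qed.

(* The generating function of a product of geometric distributions bounds the
   number of lattice points of an l1 ball, with no d ^ d factor. *)
Lemma card_lattice_l1 (d A K : nat) : (0 < A)%N ->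
  #|[pred z : {ffun 'I_d -> bool * 'I_K.+1} | \sum_i (z i).2 <= d * A]%N|%:R
  <= (8 * A.+1%:R) ^+ d :> R.
Proof.
(* This ratio keeps both factors under control: 1 / (1 - q) = A + 1, and q^(-A) = (1 + 1/A)^A is at
   most e, hence at most 4. *)
move=> A0; pose q : R := A%:R / A.+1%:R.
have A0' : 0 < A%:R :> R by rewrite ltr0n.
have q0 : 0 < q by rewrite divr_gt0.
have q1 : 1 - q = A.+1%:R^-1 by rewrite /q -natr1; field; rewrite natr1 gt_eqF.
have q1' : q < 1 by rewrite -subr_gt0 q1.
have qA : (q ^+ A)^-1 <= 4.
  apply: le_trans expR1_le4; rewrite -exprVn /q invf_div.
  have -> : A.+1%:R / A%:R = 1 + A%:R^-1 :> R by rewrite -natr1; field; rewrite gt_eqF.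
  apply: (@le_trans _ _ (expR (A%:R^-1) ^+ A)).
    by rewrite ler_pXn2r ?nnegrE ?expR_ge0 ?expR_ge1Dx// addr_ge0 ?invr_ge0.
  by rewrite -expRM_natl mulfV ?gt_eqF.
have qz (z : {ffun 'I_d -> bool * 'I_K.+1}) : 0 <= \prod_i q ^+ (z i).2.
  by rewrite prodr_ge0// => i _; rewrite exprn_ge0// ltW.
(* Each counted point has weight at least 1, its exponent being at most d A. The sum over all points
   factorizes, and a coordinate with its sign contributes at most 2 (A + 1) 4. *)
have le1 : #|[pred z : {ffun 'I_d -> bool * 'I_K.+1} | \sum_i (z i).2 <= d * A]%N|%:R
    <= \sum_(z : {ffun 'I_d -> bool * 'I_K.+1}) (\prod_i q ^+ (z i).2) / q ^+ (d * A).
  rewrite -sum1_card natr_sum big_mkcond/=; apply: ler_sum => z _.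
  case: ifP => [zA|_]; last by rewrite divr_ge0// exprn_ge0// ltW.
  rewrite ler_pdivlMr ?exprn_gt0// mul1r prodrXr.
  by apply: ler_wiXn2l => //; [rewrite ltW|rewrite ltW].
apply: (le_trans le1); rewrite -mulr_suml.
rewrite -(bigA_distr_bigA (fun (_ : 'I_d) (x : bool * 'I_K.+1) => q ^+ x.2))/=.
rewrite prodr_const card_ord mulnC exprM -expr_div_n.
have S0 : 0 <= \sum_(x : bool * 'I_K.+1) q ^+ x.2.
  by rewrite sumr_ge0// => x _; rewrite exprn_ge0// ltW.
apply: lerXn2r; rewrite ?nnegrE ?mulr_ge0 ?invr_ge0 ?exprn_ge0 ?(ltW q0)//.
have -> : \sum_(x : bool * 'I_K.+1) q ^+ x.2 = (\sum_(k < K.+1) q ^+ k) *+ 2.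
  transitivity (\sum_(b : bool) \sum_(k < K.+1) q ^+ k); first by rewrite pair_bigA.
  by rewrite sumr_const card_bool.
have := @geometric_sum_le q K.+1; rewrite q1 invrK (ltW q0) q1' => /(_ isT) h.
have -> : 8 * A.+1%:R = (A.+1%:R *+ 2) * 4 :> R by rewrite -mulr_natr; ring.
rewrite ler_pM ?lerMn2r ?invr_ge0 ?exprn_ge0 ?(ltW q0) ?mulrn_wge0 ?sumr_ge0//.
by move=> i _; rewrite exprn_ge0// ltW.
Qed.

Lemma euclidean_norm_ge0 d (v : 'rV[R]_d) : 0 <= euclidean_norm v.
Proof. exact: sqrtr_ge0. Qed.

Lemma euclidean_norm_sqr d (v : 'rV[R]_d) : euclidean_norm v ^+ 2 = \sum_i v ord0 i ^+ 2.
Proof. by rewrite sqr_sqrtr// sumr_ge0// => i _; rewrite sqr_ge0. Qed.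


(** A cell records the sign of each coordinate and its absolute value in units of h = r / sqrt d,
    rounded down. Points of one cell differ by at most h per coordinate, hence by at most r in norm.
    The cell indices lie in an l1 ball of radius d A, so the lattice count applies. *)
Lemma euclidean_cover (d : nat) (Theta : set 'rV[R]_d) (theta0 : 'rV[R]_d) (rho r : R) :
  Theta !=set0 -> (forall theta, Theta theta -> euclidean_norm (theta - theta0) <= rho) ->
  0 < rho -> 0 < r ->
  exists (I : finType) (rep : I -> 'rV[R]_d),
  [/\ forall i, Theta (rep i),
      forall theta, Theta theta -> exists i, euclidean_norm (theta - rep i) <= r &
      #|I|%:R <= (8 * (rho / r + 2)) ^+ d].
Proof.
move=> [theta1 Theta1] Tr rho0 r0; have [d0|d0] := posnP d.
  exists unit, (fun=> theta1); split => // [theta _|].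
    exists tt; rewrite /euclidean_norm big1 ?sqrtr0 ?(ltW r0)// => -[i id] _.
    by exfalso; rewrite d0 in id.
  by rewrite d0 expr0 card_unit.
pose D : R := Num.sqrt d%:R.
have D0 : 0 < D by rewrite sqrtr_gt0 ltr0n.
have D2 : D ^+ 2 = d%:R by rewrite sqr_sqrtr.
pose h := r / D; have h0 : 0 < h by rewrite divr_gt0.
pose A := (Num.truncn (rho / r)).+1; pose K := Num.truncn (rho / h).
have hA : rho / r <= A%:R.
  by rewrite ltW// /A; have /andP[] := truncn_itv (divr_ge0 (ltW rho0) (ltW r0)).
pose x (theta : 'rV[R]_d) i := (theta - theta0) ord0 i.
pose k theta i := Num.truncn (`|x theta i| / h).
pose cell theta : {ffun 'I_d -> bool * 'I_K.+1} :=
  [ffun i => (0 <= x theta i, inord (k theta i))].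
have sqx theta : Theta theta -> \sum_i x theta i ^+ 2 <= rho ^+ 2.
  move=> Tt; rewrite -euclidean_norm_sqr ler_pXn2r ?nnegrE ?euclidean_norm_ge0 ?(ltW rho0)//.
  exact: Tr.
have xrho theta i : Theta theta -> `|x theta i| <= rho.
  move=> Tt; rewrite -(ler_pXn2r (ltn0Sn 1)) ?nnegrE ?(ltW rho0)//.
  rewrite real_normK ?num_real//; apply: le_trans (sqx _ Tt).
  by rewrite (bigD1 i)//= lerDl sumr_ge0// => j _; rewrite sqr_ge0.
have kh theta i : (k theta i)%:R * h <= `|x theta i|.
  have /andP[+ _] := truncn_itv (divr_ge0 (normr_ge0 (x theta i)) (ltW h0)).
  by rewrite ler_pdivlMr.
have kh' theta i : `|x theta i| < (k theta i)%:R * h + h.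
  have /andP[_] := truncn_itv (divr_ge0 (normr_ge0 (x theta i)) (ltW h0)).
  by rewrite ltr_pdivrMr// -natr1 mulrDl mul1r.
have kK theta i : Theta theta -> (k theta i < K.+1)%N.
  move=> Tt; rewrite ltnS /k /K le_truncn// ler_wpM2r ?invr_ge0 ?(ltW h0)//.
  exact: xrho.
have cellk theta i : Theta theta -> (cell theta i).2 = k theta i :> nat.
  by move=> Tt; rewrite ffunE inordK// kK.
have cellA theta : Theta theta -> (\sum_i (cell theta i).2 <= d * A)%N.
  move=> Tt; under eq_bigr do rewrite cellk//.
  rewrite -(ler_nat R) natr_sum natrM.
  apply: (@le_trans _ _ (d%:R * (rho / r))); last by rewrite ler_wpM2l.
  have -> : d%:R * (rho / r) = (D * rho) / h.
    by rewrite -D2 /h; field; rewrite !gt_eqF.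
  rewrite ler_pdivlMr// mulr_suml; apply: (@le_trans _ _ (\sum_i `|x theta i|)).
    by apply: ler_sum => i _; exact: kh.
  (* For this c, |x| <= (x^2 / c + c) / 2 replaces Cauchy-Schwarz: after summation each of the two
     terms is at most sqrt d rho. *)
  pose c := rho / D; have c0 : 0 < c by rewrite divr_gt0.
  apply: (@le_trans _ _ (\sum_(i < d) (x theta i ^+ 2 / c + c) / 2)).
    apply: ler_sum => i _; rewrite ler_pdivlMr// -(ler_pM2r c0) mulrDl divfK ?gt_eqF//.
    rewrite -[x theta i ^+ 2]real_normK ?num_real//; have := sqr_ge0 (`|x theta i| - c); nra.
  rewrite -mulr_suml big_split/= -mulr_suml sumr_const card_ord -mulr_natl.
  have : (\sum_(i < d) x theta i ^+ 2) / c <= D * rho.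
    rewrite ler_pdivrMr// (le_trans (sqx _ Tt))// /c.
    by rewrite [leRHS](_ : _ = rho ^+ 2)//; field; rewrite gt_eqF.
  have : d%:R * c = D * rho by rewrite -D2 /c; field; rewrite gt_eqF.
  lra.
pose I := {z : {ffun 'I_d -> bool * 'I_K.+1} | (\sum_i (z i).2 <= d * A)%N}.
(* Representatives must lie in [Theta], where [f] is controlled; [theta1] is the default for cells
   that miss [Theta]. *)
pose rep (z : I) := xget theta1 [set theta | Theta theta /\ cell theta = val z].
have repP z : Theta (rep z) by rewrite /rep; case: xgetP => // y _ [].
exists I, rep; split => //; last first.
  rewrite card_sig; apply: le_trans (card_lattice_l1 _ _ _) _ => //.
  have rr0 : 0 <= rho / r by rewrite divr_ge0 ?ltW.
  have hA' : A.+1%:R <= rho / r + 2 :> R.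
    by have /andP[] := truncn_itv rr0; rewrite /A -!natr1; lra.
  by apply: lerXn2r; rewrite ?nnegrE ?mulr_ge0 ?ler0n ?addr_ge0// ler_wpM2l.
move=> theta Tt; pose z : I := exist _ (cell theta) (cellA _ Tt); exists z.
have cz : cell (rep z) = cell theta.
  rewrite /rep; case: xgetP => [y _ []//|/(_ theta)] nP.
  by exfalso; apply: nP.
have xz i : `|(theta - rep z) ord0 i| <= h.
  have -> : (theta - rep z) ord0 i = x theta i - x (rep z) i.
    by rewrite /x !mxE; ring.
  have e1 : k (rep z) i = k theta i by rewrite -!cellk ?cz.
  have e2 : (0 <= x (rep z) i) = (0 <= x theta i).
    by have := congr1 (fun f : {ffun _} => (f i).1) cz; rewrite !ffunE.
  have := kh theta i; have := kh' theta i; have := kh (rep z) i; have := kh' (rep z) i.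
  rewrite e1 ler_norml; case: (leP 0 (x theta i)) e2 => s1 s2.
    by rewrite !ger0_norm ?s2//; lra.
  have s3 : x (rep z) i < 0 by rewrite ltNge s2.
  by rewrite !ltr0_norm//; lra.
rewrite -(ler_pXn2r (ltn0Sn 1)) ?nnegrE ?euclidean_norm_ge0 ?(ltW r0)//.
rewrite euclidean_norm_sqr.
apply: (@le_trans _ _ (\sum_(i < d) h ^+ 2)).
  apply: ler_sum => i _; rewrite -[leLHS]real_normK ?num_real//.
  by rewrite ler_pXn2r ?nnegrE ?(ltW h0).
rewrite sumr_const card_ord -mulr_natl -D2 /h.
by rewrite [leLHS](_ : _ = r ^+ 2)//; field; rewrite gt_eqF.
Qed.

End EuclideanCover.

(** * Comparison of optimal risks under two kernels *)

Section OptimalRisk.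
Context {R : realType} {T : nat} {M : mdp R T}.

Lemma card_le1_distr (V : finType) (p : V -> R) v : (#|V| <= 1)%N -> is_distr p -> p v = 1.
Proof.
move=> /fintype_le1P V1 [_ <-]; rewrite (bigD1 v)//= big1 ?addr0// => w.
by rewrite (V1 w v) eqxx.
Qed.

Section Extensionality.
Variables P Q : transition_kernel M.
Arguments P : clear implicits.
Arguments Q : clear implicits.
Hypothesis PQ : forall t (s : state M t) a s', (t < T)%N -> P t s a s' = Q t s a s'.

Lemma hist_prob_ext pi s t (h : hist M t) : (t <= T)%N ->
  hist_prob P pi s h = hist_prob Q pi s h.
Proof. by elim: t h => [//|t ih] h tT /=; rewrite ih ?PQ// ltnW. Qed.

Lemma opt_risk_ext d (Theta : set 'rV[R]_d) f s :
  opt_risk Theta f P s = opt_risk Theta f Q s.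
Proof.
have e pi g : expect_total_cost P pi s g = expect_total_cost Q pi s g.
  by apply: eq_bigr => h _; apply: eq_bigr => a _; rewrite hist_prob_ext.
rewrite /opt_risk /risk; congr (inf (image _ _)); apply/funext => pi.
by congr (inf (image _ _)); apply/funext => theta.
Qed.

End Extensionality.

(** The uniform bound [c] makes both infima genuine: the real [inf] of a set unbounded below is a
    default value. *)
Lemma opt_risk_le (P Q : transition_kernel M) d (Theta : set 'rV[R]_d) f s (c eps : R) :
  Theta !=set0 ->
  (forall pi theta, policies pi -> Theta theta ->
    c <= expect_total_cost P pi s (f theta)) ->
  (forall pi theta, policies pi -> Theta theta -> exists pi' theta',
    [/\ policies pi', Theta theta' &
      expect_total_cost P pi' s (f theta') <=
      expect_total_cost Q pi s (f theta) + eps]) ->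
  opt_risk Theta f P s <= opt_risk Theta f Q s + eps.
Proof.
move=> Theta0 lb PQ; rewrite -lerBlDr; apply: lb_le_inf.
  (* Any policy would do; this one shows that the set of risks is nonempty. *)
  exists (risk Theta f Q (greedy P (fun=> 0)) s) => /=.
  by exists (greedy P (fun=> 0)) => //; exact: greedy_policy.
move=> _ [pi piD <-]; apply: lb_le_inf.
  by have [theta Tt] := Theta0; exists (expect_total_cost Q pi s (f theta)), theta.
move=> _ [theta Tt <-]; have [pi' [theta' [piD' Tt' le]]] := PQ _ _ piD Tt.
rewrite lerBlDr; apply: le_trans le.
have lbr pi0 : policies pi0 ->
    lbound [set expect_total_cost P pi0 s (f theta) | theta in Theta] c.
  by move=> ? _ [theta0 ? <-]; exact: lb.
apply: (@le_trans _ _ (risk Theta f P pi' s)).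
  apply: ge_inf; last by exists pi'.
  exists c => _ [pi0 pi0D <-]; apply: lb_le_inf; last exact: lbr.
  by have [theta0 Tt0] := Theta0; exists (expect_total_cost P pi0 s (f theta0)), theta0.
by apply: ge_inf; [exists c; exact: lbr|exists theta'].
Qed.

Fixpoint first_cost t : hist M t -> R :=
  match t with
  | 0 => fun=> 0
  | t'.+1 => fun h =>
      if (t' == 0)%N then cost (last_state h.1.1) h.1.2 else first_cost h.1.1
  end.

Lemma hist_cost_first t (h : hist M t.+1) : (t <= T)%N ->
  first_cost h <= hist_cost h <= first_cost h + t%:R.
Proof.
elim: t h => [|t ih] h tT; first by rewrite /= add0r addr0 lexx.
have := ih h.1.1 (ltnW tT).
have := cost_itv (last_state (h.1.1 : hist M t.+1)) h.1.2 tT.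
by rewrite -natr1/=; lra.
Qed.

(** Before stage 1 the first cost is unknown and its mean is used; afterwards the process is
    constant along the history, hence a martingale. *)
Definition first_stage_mean (pi : policy M) (F : R -> R) t : hist M t -> R :=
  match t with
  | 0 => fun s => \sum_a pi 0 s a * F (cost (t := 0) s a)
  | t'.+1 => fun h => F (first_cost h)
  end.

Lemma first_stage_mean_gt0 pi F t (h : hist M t) : (0 < t)%N ->
  first_stage_mean pi F h = F (first_cost h).
Proof. by case: t h. Qed.

(* Only the costs of the stages 1, ..., T depend on the kernel. *)
Lemma expect_first_stage_le (P : transition_kernel M) pi s (F g : R -> R) :
  is_kernel P -> policies pi -> (0 < T)%N ->
  (forall c z, 0 <= c <= z -> z <= c + T%:R -> z <= T%:R + 1 -> F c <= g z) ->
  \sum_a pi 0 s a * F (cost (t := 0) s a) <= expect_total_cost P pi s g.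
Proof.
move=> PD piD T0 Fg.
rewrite [leLHS](_ : _ = first_stage_mean pi F (t := 0) s - T%:R * 0); last first.
  by rewrite mulr0 subr0.
apply: drift_expect => // [t h tT|h].
  rewrite subr0; case: t h tT => [|t] h tT /=.
    apply: ler_sum => a _; rewrite (distr_cst (PD _ h a tT)).
    by rewrite ler_wpM2l// (distr_ge0 (piD _ _ _)).
  rewrite [leLHS](_ : _ = \sum_a pi t.+1 h a * F (first_cost h)).
    apply: ler_sum => a _; rewrite (distr_cst (PD _ _ a tT)).
    by rewrite ler_wpM2l// (distr_ge0 (piD _ _ _))// ltnW.
  by rewrite (distr_cst (piD _ _ (ltnW tT))).
rewrite first_stage_mean_gt0//; apply: (distr_ge (piD _ h (leqnn T))) => a.
have ct := cost_itv (last_state h) a (leqnn T).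
have hT := hist_cost_itv h (leqnSn T).
(* The type of [h] depends on [T], so t + 1 is not substituted for [T]; the bounds are stated for
   every length equal to t + 1. *)
have [t Tt] : exists t, T = t.+1 by exists T.-1; rewrite prednK.
have tT : (t <= T)%N by rewrite Tt.
have fc k (h' : hist M k) : (k = t.+1)%N ->
    0 <= first_cost h' /\ first_cost h' <= hist_cost h' <= first_cost h' + t%:R.
  move=> kt; move: h'; rewrite kt => h'; split; last exact: hist_cost_first.
  move: (t) (tT) h' => k'; elim: k' => [|k' ih] kT h'.
    by have := cost_itv (last_state (h'.1.1 : hist M 0)) h'.1.2 kT => /andP[].
  by rewrite [first_cost h']/=; exact: ih (ltnW kT) _.
have [h0 h1] := fc _ h Tt.
have : T%:R = t%:R + 1 :> R by rewrite natr1 Tt.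
by move=> TR; apply: Fg; move: ct hT h1; rewrite TR; lra.
Qed.

(** The law of A_0 depends on [pi] and [s] alone, so both expectations are compared with one
    function of the first cost. This leaves T uncertain costs instead of T + 1. *)
Lemma expect_total_cost_close (P Q : transition_kernel M) pi s (g : R -> R) (L : R) :
  is_kernel P -> is_kernel Q -> policies pi -> (0 < T)%N -> 0 <= L ->
  (forall z z', 0 <= z <= T%:R + 1 -> 0 <= z' <= T%:R + 1 ->
    `|g z - g z'| <= L * `|z - z'|) ->
  expect_total_cost P pi s g <= expect_total_cost Q pi s g + L * T%:R.
Proof.
move=> PD QD piD T0 L0 gL; have Tr : 1 <= T%:R :> R by rewrite ler1n.
(* g varies by at most L T / 2 around c + T / 2 on [c, c + T]. *)
pose F (c : R) := g (Num.min (c + T%:R / 2) (T%:R + 1)) - L * T%:R / 2.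
pose F' (c : R) := - g (Num.min (c + T%:R / 2) (T%:R + 1)) - L * T%:R / 2.
(* The minimum keeps the midpoint in the range where [g] is Lipschitz, as [c] is bounded only
   through [z]. *)
have gc c z : 0 <= c <= z -> z <= c + T%:R -> z <= T%:R + 1 ->
    `|g z - g (Num.min (c + T%:R / 2) (T%:R + 1))| <= L * T%:R / 2.
  move=> cz zc zT; apply: le_trans (gL _ _ _ _) _.
  - lra.
  - by rewrite le_min ge_min; lra.
  rewrite -mulrA ler_wpM2l// ler_norml.
  by have [] := leP (c + T%:R / 2) (T%:R + 1); lra.
have h1 : \sum_a pi 0 s a * F (cost (t := 0) s a) <= expect_total_cost Q pi s g.
  apply: expect_first_stage_le => // c z cz zc zT; have := gc c z cz zc zT.
  by rewrite ler_norml /F; lra.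
have h2 : \sum_a pi 0 s a * F' (cost (t := 0) s a) <=
    expect_total_cost P pi s (fun z => (-1) * g z).
  apply: expect_first_stage_le => // c z cz zc zT; have := gc c z cz zc zT.
  by rewrite ler_norml /F'; lra.
move: h2; rewrite expect_total_cost_scale.
rewrite (eq_bigr (fun a => pi 0 s a * (- 1 * F (cost (t := 0) s a) + - (L * T%:R)))).
  rewrite (distr_addr (piD 0 s (leq0n T))).
  rewrite (eq_bigr (fun a => - (pi 0 s a * F (cost (t := 0) s a)))).
    by rewrite sumrN; lra.
  by move=> a _; ring.
by move=> a _; congr (_ * _); rewrite /F /F'; lra.
Qed.

End OptimalRisk.

(** * Sign and boundedness consequences of the risk assumption *)

Section RiskFamily.
Context {R : realType} {T d : nat} {Theta : set 'rV[R]_d} {f : 'rV[R]_d -> R -> R}.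
Context {L_C L_Theta R_Theta : R}.
Hypothesis fam : risk_family_assumption T Theta f L_C L_Theta R_Theta.

Lemma risk_family_L_C_ge0 : 0 <= L_C.
Proof.
have [[theta Tt] _ fL _] := fam; have := fL theta 1 0 Tt.
rewrite subr0 normr1 mulr1 => h; apply: le_trans (h _ _) => //.
  by rewrite ler01 lerDr ler0n.
by rewrite lexx addr_ge0.
Qed.

Lemma risk_family_lb :
  exists c, forall theta z, Theta theta -> 0 <= z <= T%:R + 1 -> c <= f theta z.
Proof.
have [[theta1 Tt1] [theta0 Tr] fL fT] := fam; have L0 := risk_family_L_C_ge0.
(* From (theta1, 0), the cost moves by at most T + 1 and theta by at most the diameter
   [2 * R_Theta]; the absolute value allows either sign of [L_Theta]. *)
exists (f theta1 0 - L_C * (T%:R + 1) - `|L_Theta| * (2 * R_Theta)) => theta z Tt hz.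
have Rt0 : 0 <= R_Theta by apply: le_trans (Tr _ Tt1); exact: euclidean_norm_ge0.
have n2 : euclidean_norm (theta - theta1) <= 2 * R_Theta.
  rewrite -(ler_pXn2r (ltn0Sn 1)) ?nnegrE ?euclidean_norm_ge0 ?mulr_ge0//.
  have sq t : Theta t -> \sum_i (t - theta0) ord0 i ^+ 2 <= R_Theta ^+ 2.
    move=> tT; rewrite -euclidean_norm_sqr.
    by rewrite ler_pXn2r ?nnegrE ?euclidean_norm_ge0// Tr.
  have := sq _ Tt; have := sq _ Tt1; rewrite euclidean_norm_sqr => s1 s2.
  have : \sum_i (theta - theta1) ord0 i ^+ 2 <=
    2 * (\sum_i (theta - theta0) ord0 i ^+ 2) + 2 * (\sum_i (theta1 - theta0) ord0 i ^+ 2).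
    rewrite !mulr_sumr -big_split/=; apply: ler_sum => i _; rewrite !mxE.
    by have := sqr_ge0 (theta ord0 i - theta0 ord0 i + (theta1 ord0 i - theta0 ord0 i)); nra.
  by rewrite exprMn; lra.
have z0 : 0 <= (0 : R) <= T%:R + 1 by rewrite lexx addr_ge0.
have := fL theta z 0 Tt hz z0; rewrite subr0 => h1.
have := fT theta theta1 0 Tt Tt1 z0 => h2.
have h3 : L_C * `|z| <= L_C * (T%:R + 1).
  by rewrite ler_wpM2l// ger0_norm; move: hz => /andP[].
have h4 : L_Theta * euclidean_norm (theta - theta1) <= `|L_Theta| * (2 * R_Theta).
  apply: le_trans (ler_norm _) _; rewrite normrM ler_wpM2l//.
  by rewrite ger0_norm ?euclidean_norm_ge0.
by move: h1 h2; rewrite !ler_norml; lra.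
Qed.

End RiskFamily.

(** * Normalization of the utility *)

Section NormalizedUtility.
Context {R : realType}.

Lemma clamp_lip (c z z' : R) : 0 <= c ->
  `|Num.min (Num.max z 0) c - Num.min (Num.max z' 0) c| <= `|z - z'|.
Proof.
move=> c0; wlog zz : z z' / z' <= z => [hw|].
  have [/hw//|/ltW/hw] := leP z' z.
  by rewrite distrC [`|z - z'|]distrC.
rewrite [leRHS]ger0_norm ?subr_ge0// ler_norml.
have [z0|z0] := leP z 0; have [z0'|z0'] := leP z' 0;
  have [zc|zc] := leP z c; have [zc'|zc'] := leP z' c;
  have [c0'|c0'] := leP 0 c; lra.
Qed.

Variables (T : nat) (g : R -> R) (L : R).
Hypothesis gL : forall z z', 0 <= z <= T%:R + 1 -> 0 <= z' <= T%:R + 1 ->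
  `|g z - g z'| <= L * `|z - z'|.
Hypothesis L0 : 0 < L.

Let B := L * (T%:R + 1).

(** Clamping extends [g] from [0, T + 1] to a Lipschitz function on the line; division by [B] brings
    the values into [-1, 1] and the Lipschitz constant to 1 / (T + 1). *)
Definition utility (z : R) : R :=
  (g (Num.min (Num.max z 0) (T%:R + 1)) - g 0) / B.

Let B0 : 0 < B. Proof. by rewrite mulr_gt0// ltr_wpDl. Qed.

Let clamp_itv (z : R) : 0 <= Num.min (Num.max z 0) (T%:R + 1) <= T%:R + 1.
Proof. by rewrite le_min le_max lexx orbT ge_min lexx orbT addr_ge0. Qed.

Lemma utilityE z : 0 <= z <= T%:R + 1 -> g z = B * utility z + g 0.
Proof.
move=> /andP[z0 zT]; rewrite /utility max_l// min_l//.
by rewrite mulrC divfK ?gt_eqF// subrK.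
Qed.

Lemma utility_norm z : `|utility z| <= 1.
Proof.
rewrite /utility normrM normfV (gtr0_norm B0) ler_pdivrMr// mul1r.
apply: le_trans (gL _ _) _ => //; first by rewrite lexx addr_ge0.
by rewrite subr0 ler_wpM2l ?(ltW L0)// ger0_norm; have /andP[] := clamp_itv z.
Qed.

Lemma utility_lip z z' : utility z - utility z' <= (T%:R + 1)^-1 * `|z - z'|.
Proof.
have T1 : 0 < T%:R + 1 :> R by rewrite ltr_wpDl.
rewrite /utility -mulrBl ler_pdivrMr//.
have -> : (T%:R + 1)^-1 * `|z - z'| * B = L * `|z - z'| by rewrite /B; field; rewrite gt_eqF.
rewrite opprB addrA subrK; apply: le_trans (ler_norm _) _.
apply: le_trans (gL _ _) _ => //; rewrite ler_wpM2l ?(ltW L0)//.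
by apply: clamp_lip; exact: ltW.
Qed.

End NormalizedUtility.

(** * From calibration to closeness of the optimal risks *)

Section Pivot.
Context {R : realType} {T : nat} {M : mdp R T} {d : nat}.
Context {Theta : set 'rV[R]_d} {f : 'rV[R]_d -> R -> R}.
Context {L_C L_Theta R_Theta : R}.
Hypothesis fam : risk_family_assumption T Theta f L_C L_Theta R_Theta.
Hypothesis L_C0 : 0 < L_C.

Let B := L_C * (T%:R + 1).

Lemma expect_utility (P : transition_kernel M) pi s theta :
  is_kernel P -> policies pi ->
  expect_total_cost P pi s (f theta) =
  B * expect_total_cost P pi s (utility T (f theta) L_C) + f theta 0.
Proof.
move=> PD piD; rewrite -expect_total_cost_scale -expect_total_cost_addr//.
have fE z := @utilityE R T (f theta) L_C L_C0 z.
by apply/le_anti/andP; split; apply: expect_total_cost_le => // z hz; rewrite (fE z hz).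
Qed.

(** Both directions use the greedy policy of the true kernel and a net point near theta. Up to the
    error, calibration at [kappa] puts its true cost below the cost of any policy under [Q], and
    calibration at [- kappa] puts its cost under [Q] below the true value. The net costs eps / 4,
    and [err] bounds the rest. *)
Lemma opt_risk_close (Q : transition_kernel M) (I : finType) (rep : I -> 'rV[R]_d)
    (eps eta beta kappa : R) (K : nat) (s : state M 0) :
  is_kernel Q ->
  (forall i, Theta (rep i)) ->
  (forall theta, Theta theta -> exists i, forall z, 0 <= z <= T%:R + 1 ->
    `|f theta z - f (rep i) z| <= eps / 4) ->
  0 < kappa <= 1 / 2 -> 0 < eta -> T%:R <= K%:R * eta ->
  (forall i, grid_calibrated (@trans R T M) Q (utility T (f (rep i)) L_C) eta beta
    K kappa) ->
  (forall i, grid_calibrated (@trans R T M) Q (utility T (f (rep i)) L_C) eta beta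
    K (- kappa)) ->
  B * (2 * kappa + T%:R * (beta + 4 * kappa * (T%:R + 1)^-1 * eta) / kappa)
    <= eps * (3 / 4) ->
  `|opt_risk Theta f Q s - opt_risk Theta f (@trans R T M) s| <= eps.
Proof.
move=> QD Trep cover kap eta0 etaK cal calN err.
have PD : is_kernel (@trans R T M) := @trans_distr R T M.
have B0 : 0 <= B by rewrite mulr_ge0 ?(ltW L_C0)// addr_ge0.
have [Tne _ fL _] := fam.
have [c fc] := risk_family_lb fam.
have lb (P : transition_kernel M) : is_kernel P ->
    forall pi theta, policies pi -> Theta theta ->
    c <= expect_total_cost P pi s (f theta).
  by move=> kP pi theta piD Tt; apply: expect_total_cost_lb => // z; exact: fc.
have u1 i := @utility_norm R T (f (rep i)) L_C (fun z z' => fL _ z z' (Trep i)) L_C0.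
have ul i := @utility_lip R T (f (rep i)) L_C (fun z z' => fL _ z z' (Trep i)) L_C0.
have lam0 : 0 <= (T%:R + 1)^-1 :> R by rewrite invr_ge0 addr_ge0.
have cov (P : transition_kernel M) pi theta i : is_kernel P -> policies pi ->
    (forall z, 0 <= z <= T%:R + 1 -> `|f theta z - f (rep i) z| <= eps / 4) ->
    expect_total_cost P pi s (f (rep i)) <= expect_total_cost P pi s (f theta) + eps / 4.
  move=> kP piD close; rewrite -expect_total_cost_addr//.
  apply: expect_total_cost_le => // z hz.
  by have := close z hz; rewrite ler_norml; lra.
have /andP[k0 k2] := kap.
have knorm : `|kappa| = kappa by rewrite gtr0_norm.
suff [h1 h2] : opt_risk Theta f (@trans R T M) s <= opt_risk Theta f Q s + eps /\
    opt_risk Theta f Q s <= opt_risk Theta f (@trans R T M) s + eps.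
  by rewrite ler_norml; lra.
split.
  apply: (opt_risk_le Tne (lb _ PD)) => pi theta piD Tt.
  have [i close] := cover _ Tt.
  exists (greedy (@trans R T M) (utility T (f (rep i)) L_C)), (rep i).
  split => //; first exact: greedy_policy.
  have := cov Q pi theta i QD piD close.
  rewrite !expect_utility//; last exact: greedy_policy.
  have := expect_greedy_le (utility T (f (rep i)) L_C) PD s.
  have := value_le_expect PD QD (u1 i) (ul i) lam0 eta0 etaK s kap (cal i) piD.
  rewrite knorm; move: err; set e := (X in X / kappa).
  set E1 := expect_total_cost _ (greedy _ _) s (utility T (f (rep i)) L_C).
  set E2 := expect_total_cost _ pi s (utility T (f (rep i)) L_C) => err h1 h2.
  have : B * E1 <= B * (E2 + (2 * kappa + e / kappa)) by rewrite ler_wpM2l//; lra.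
  rewrite mulrDr; lra.
apply: (opt_risk_le Tne (lb _ QD)) => pi theta piD Tt.
have [i close] := cover _ Tt.
exists (greedy (@trans R T M) (utility T (f (rep i)) L_C)), (rep i).
split => //; first exact: greedy_policy.
have := cov (@trans R T M) pi theta i PD piD close.
rewrite !expect_utility//; last exact: greedy_policy.
have := value_expect_le (utility T (f (rep i)) L_C) PD s piD.
have := @expect_greedy_le_value _ _ _ (@trans R T M) Q _ _ _ beta (- kappa) K
  PD QD (u1 i) (ul i) lam0 eta0 etaK s.
rewrite opprK normrN knorm => /(_ kap (calN i)).
move: err; set e := (X in X / kappa).
set E1 := expect_total_cost _ (greedy _ _) s (utility T (f (rep i)) L_C).
set E2 := expect_total_cost _ pi s (utility T (f (rep i)) L_C) => err h1 h2.
have : B * E1 <= B * (E2 + (2 * kappa + e / kappa)) by rewrite ler_wpM2l//; lra.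
rewrite mulrDr; lra.
Qed.

End Pivot.

(** * Numerical estimates for the union bound *)

Section Numerics.
Context {R : realType}.

(** Since (3/4) (2/3) = 1/2 and ln (1 + x) <= x, ln 2 >= 1/4 + 1/3 = 7/12. *)
Lemma ln_max2_ge (x : R) : 7 / 12 <= ln (Num.max 2 x).
Proof.
apply: (@le_trans _ _ (ln 2)); last first.
  by rewrite ler_ln ?posrE ?le_max ?lexx// lt_max ltr0n.
have h1 := @le_ln1Dx R (- (1 / 4)); have h2 := @le_ln1Dx R (- (1 / 3)).
have e : (1 + - (1 / 4)) * (1 + - (1 / 3)) = 2^-1 :> R by field.
have : ln ((1 + - (1 / 4)) * (1 + - (1 / 3))) = - ln 2 :> R.
  by rewrite e lnV// posrE ltr0n.
rewrite lnM ?posrE; [|lra..].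
by move=> h; have := h1 _; have := h2 _; lra.
Qed.

(** The left side counts the bad events: stages, state-action pairs, grid points, two signs and net
    points. *)
Lemma union_size_le (T S A u delta m b k N : R) (d : nat) :
  1 <= T -> 2 <= S -> 1 <= A -> 1 <= T * u -> 0 < delta < 1 -> 2 <= m -> 7 / 12 <= b ->
  0 <= k <= 18 * (T ^+ 2 * u) -> 0 <= N <= (64 * m) ^+ d ->
  T * (S * A) * k * 2 * N <=
  delta * (T ^+ 7 * S * A * u ^+ 3 * b * m ^+ d / delta) ^+ 32.
Proof.
move=> T1 S2 A1 Tu1 /andP[d0 d1] m2 b7 /andP[k0 kT] /andP[N0 Nm].
have T0 : 0 < T by lra.
have u0 : 0 < u by rewrite -(pmulr_rgt0 _ T0); lra.
pose p := T ^+ 7 * S * A * u ^+ 3; pose q := p / delta; pose x := m ^+ d.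
have SA2 : 2 <= S * A by nra.
have p2 : 2 <= p.
  have -> : p = T ^+ 4 * (T * u) ^+ 3 * (S * A) by rewrite /p; ring.
  rewrite -[leLHS]mul1r ler_pM//.
  by rewrite -[leLHS]mulr1 ler_pM// ?exprn_ege1.
have q2 : 2 <= q by rewrite /q ler_pdivlMr//; nra.
have x1 : 1 <= x by rewrite exprn_ege1//; lra.
have le1 : T * (S * A) * k <= 18 * p.
  apply: (@le_trans _ _ (T * (S * A) * (18 * (T ^+ 2 * u)))).
    by rewrite ler_wpM2l// !mulr_ge0//; lra.
  have -> : T * (S * A) * (18 * (T ^+ 2 * u)) = 18 * ((S * A) * (T ^+ 3 * u)) by ring.
  have -> : 18 * p = 18 * ((S * A) * (T ^+ 3 * u) * (T ^+ 2 * (T * u) ^+ 2)).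
    by rewrite /p; ring.
  rewrite ler_wpM2l// ler_peMr//.
    by rewrite !mulr_ge0 ?exprn_ge0//; lra.
  by rewrite -[leLHS]mulr1 ler_pM// ?exprn_ege1.
(* As m >= 2, 64 <= m^6, so the dimension-dependent 64^d is absorbed by a power of m^d. *)
have le2 : N <= x ^+ 7.
  apply: (le_trans Nm); rewrite /x -exprM mulnC exprM.
  apply: lerXn2r; rewrite ?nnegrE ?mulr_ge0 ?exprn_ge0//; try lra.
  have -> : m ^+ 7 = m ^+ 6 * m by rewrite -exprSr.
  rewrite ler_wpM2r//; first lra.
  apply: (@le_trans _ _ (2 ^+ 6)); first lra.
  by apply: lerXn2r; rewrite ?nnegrE//; lra.
have le3 : T * (S * A) * k * 2 * N <= 36 * p * x ^+ 7.
  apply: ler_pM => //; last by lra.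
  by rewrite !mulr_ge0//; lra.
apply: (le_trans le3).
have -> : T ^+ 7 * S * A * u ^+ 3 * b * m ^+ d / delta = q * b * x.
  by rewrite /q /p /x; field; rewrite gt_eqF.
have -> : 36 * p * x ^+ 7 = delta * (36 * q * x ^+ 7).
  by rewrite /q; field; rewrite gt_eqF.
rewrite ler_wpM2l ?(ltW d0)// [leRHS]exprMn.
move: q q2 => {le1 le2 le3 p2} q q2.
have q0 : 0 <= q by lra.
apply: ler_pM; [by rewrite mulr_ge0|by rewrite exprn_ge0//; lra| |by apply: ler_weXn2l].
(* From q b >= 7/6, (q b)^28 >= 64; one more factor q b gives 64 (7/12) q, which exceeds 36 q. *)
have qb : 7 / 6 <= q * b.
  by rewrite [leLHS](_ : _ = 2 * (7 / 12)); [rewrite ler_pM//; lra|lra].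
apply: (@le_trans _ _ ((q * b) ^+ 29)); last by apply: ler_weXn2l => //; lra.
have h4 : 37 / 20 <= (q * b) ^+ 4.
  apply: (@le_trans _ _ ((7 / 6) ^+ 4)); first lra.
  by apply: lerXn2r; rewrite ?nnegrE//; lra.
have h28 : 64 <= (q * b) ^+ 28.
  rewrite [_ ^+ 28](exprM _ 4 7); apply: (@le_trans _ _ ((37 / 20) ^+ 7)); first lra.
  by apply: lerXn2r; rewrite ?nnegrE//; lra.
rewrite exprSr; apply: (@le_trans _ _ (64 * (q * b))); last first.
  by rewrite ler_wpM2r//; lra.
have : q * (7 / 12) <= q * b by rewrite ler_wpM2l.
lra.
Qed.

End Numerics.

(** * The union bound and the probability of closeness *)

Section SampleComplexity.
Context {R : realType} {T : nat} (M : mdp R T).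

Definition stage_pair : finType := {t : 'I_T & (state M t * action M t)%type}.

Lemma card_stage_pair :
  (#|stage_pair| <= T * (max_card_state M * max_card_action M))%N.
Proof.
rewrite card_tagged sumnE big_map big_enum/= -[X in (_ <= X * _)%N]card_ord -sum_nat_const.
apply: leq_sum => t _; rewrite card_prod.
have tT : (t < T.+1)%N by exact: leqW.
apply: leq_mul.
  exact: (leq_bigmax (F := fun i : 'I_T.+1 => #|state M i|) (Ordinal tT)).
exact: (leq_bigmax (F := fun i : 'I_T.+1 => #|action M i|) (Ordinal tT)).
Qed.

Lemma max_card_action_gt0 : (0 < max_card_action M)%N.
Proof.
apply: leq_trans (action_gt0 M 0) _.
exact: (leq_bigmax (F := fun i : 'I_T.+1 => #|action M i|) ord0).
Qed.

Section Event.
Context {d : nat} {Theta : set 'rV[R]_d} {f : 'rV[R]_d -> R -> R}.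
Context {L_C L_Theta R_Theta eps delta : R} {n : nat}.
Context {disp : measure_display} {Omega : measurableType disp}.
Context {Pr : probability Omega R} {X : @samples R T M n disp Omega}.
Hypothesis fam : risk_family_assumption T Theta f L_C L_Theta R_Theta.
Hypotheses (T0 : (0 < T)%N) (eps0 : 0 < eps) (delta01 : 0 < delta < 1).
Hypothesis n0 : (0 < n)%N.
Hypothesis iid : iid_samples Pr X.

Let close w (s : state M 0) : Prop :=
  (`|opt_risk Theta f (empirical_kernel X w) s
     - opt_risk Theta f (@trans R T M) s| <= eps)%R.

Let PD : is_kernel (@trans R T M) := @trans_distr R T M.
Let QD w : is_kernel (empirical_kernel X w).
Proof. by move=> t s a _; exact: empirical_distr. Qed.

Lemma close_of_small_L_C w s : L_C * T%:R <= eps -> close w s.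
Proof.
move=> LT; have [Tne _ fL _] := fam; have [c fc] := risk_family_lb fam.
have L0 := risk_family_L_C_ge0 fam.
have lb (P : transition_kernel M) : is_kernel P ->
    forall pi theta, policies pi -> Theta theta ->
    c <= expect_total_cost P pi s (f theta).
  by move=> kP pi theta piD Tt; apply: expect_total_cost_lb => // z; exact: fc.
suff h (P Q : transition_kernel M) : is_kernel P -> is_kernel Q ->
    opt_risk Theta f P s <= opt_risk Theta f Q s + eps.
  have := h _ _ (QD w) PD; have := h _ _ PD (QD w).
  by rewrite /close ler_norml; lra.
move=> kP kQ; apply: (opt_risk_le Tne (lb _ kP)) => pi theta piD Tt.
exists pi, theta; split=> //.
apply: (@le_trans _ _ (expect_total_cost Q pi s (f theta) + L_C * T%:R)).
  by apply: expect_total_cost_close => // z z'; exact: fL.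
by rewrite lerD2l.
Qed.

Lemma close_of_single_state w s : (max_card_state M <= 1)%N -> close w s.
Proof.
move=> S1; rewrite /close (@opt_risk_ext _ _ _ _ (@trans R T M)) ?subrr ?normr0 ?ltW//.
move=> t s1 a s' tT.
have c1 : (#|state M t.+1| <= 1)%N.
  apply: leq_trans S1; have tT' : (t.+1 < T.+1)%N by [].
  exact: (leq_bigmax (F := fun i : 'I_T.+1 => #|state M i|) (Ordinal tT')).
by rewrite !card_le1_distr//; [exact: PD|exact: QD].
Qed.

Lemma close_measurable : measurable [set w | forall s, close w s].
Proof.
apply: (determined_measurable iid) => w w' ww' cw s; have := cw s.
rewrite /close (@opt_risk_ext _ _ _ (empirical_kernel X w) (empirical_kernel X w'))//.
move=> t s1 a s' tT; rewrite /empirical_kernel; congr (_ / _).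
by apply: eq_bigr => i _; rewrite ww'.
Qed.

Lemma theta_cover (m : R) : 2 <= m -> L_Theta * R_Theta / eps <= m ->
  exists (I : finType) (rep : I -> 'rV[R]_d),
  [/\ forall i, Theta (rep i),
      forall theta, Theta theta -> exists i, forall z, 0 <= z <= T%:R + 1 ->
        `|f theta z - f (rep i) z| <= eps / 4 &
      #|I|%:R <= (64 * m) ^+ d].
Proof.
move=> m2 mL; have [Tne [theta0 Tr] _ fT] := fam.
(* These replacements make L nonnegative and rho positive; eps / (L + 1) is small enough to keep L
   rho <= m eps. *)
pose L := Num.max L_Theta 0; pose rho := Num.max R_Theta (eps / (L + 1)).
have L0 : 0 <= L by rewrite le_max lexx orbT.
have rho0 : 0 < rho by rewrite lt_max (divr_gt0 eps0) ?orbT//; lra.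
have m0 : 0 < m by lra.
have Lrho : L * rho <= m * eps.
  have e1 : L * (eps / (L + 1)) <= m * eps.
    apply: (@le_trans _ _ eps); last by rewrite ler_peMl ?(ltW eps0)//; lra.
    by rewrite mulrA ler_pdivrMr ?ltr_wpDl// mulrDr mulr1 [L * _]mulrC lerDl ltW.
  have e2 : L * R_Theta <= m * eps.
    rewrite /L; case: (leP L_Theta 0) => _; first by rewrite mul0r mulr_ge0// ltW.
    by rewrite -ler_pdivrMr.
  by rewrite /rho; case: (leP R_Theta (eps / (L + 1))).
(* This radius gives L r <= eps / 4, and the cover has at most (8 (4 m + 2))^d <= (64 m)^d
   points. *)
pose r := rho / (4 * m); have r0 : 0 < r by rewrite divr_gt0//; lra.
have Tr' theta : Theta theta -> euclidean_norm (theta - theta0) <= rho.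
  by move=> Tt; apply: le_trans (Tr _ Tt) _; rewrite le_max lexx.
have [I [rep [Trep cov card]]] := euclidean_cover Tne Tr' rho0 r0.
exists I, rep; split=> // [theta Tt|].
  have [i hi] := cov _ Tt; exists i => z hz.
  apply: le_trans (fT _ _ _ Tt (Trep i) hz) _.
  apply: (@le_trans _ _ (L * r)).
    apply: (@le_trans _ _ (L * euclidean_norm (theta - rep i))).
      by rewrite ler_wpM2r ?euclidean_norm_ge0// le_max lexx.
    by rewrite ler_wpM2l.
  rewrite /r mulrA ler_pdivrMr; last lra.
  by rewrite (le_trans Lrho)//; lra.
apply: (le_trans card).
have -> : rho / r = 4 * m by rewrite /r; field; rewrite !gt_eqF.
by apply: lerXn2r; rewrite ?nnegrE; lra.
Qed.

Lemma close_probability :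
  eps < L_C * T%:R -> (1 < max_card_state M)%N ->
  4096 * sample_complexity T (max_card_state M) (max_card_action M) d
    L_C L_Theta R_Theta eps delta <= n%:R ->
  ((1 - delta)%:E <= Pr [set w | forall s, close w s])%E.
Proof.
move=> LT S2; rewrite /sample_complexity.
set S : R := (max_card_state M)%:R; set A : R := (max_card_action M)%:R.
set b := ln (Num.max 2 (T%:R ^+ 2 * _ * _ / _)); set m := Num.max 2 (L_Theta * _ / _).
set x := _ / (delta * _) => hn.
have Tr : 1 <= T%:R :> R by rewrite ler1n.
have Tr0 : 0 < T%:R :> R by rewrite ltr0n.
have L0 : 0 < L_C by rewrite -(pmulr_lgt0 L_C Tr0) (lt_trans eps0).
have m2 : 2 <= m by rewrite le_max lexx.
have mL : L_Theta * R_Theta / eps <= m by rewrite le_max lexx orbT.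
have [I [rep [Trep cov card]]] := theta_cover m2 mL.
have [_ _ fL _] := fam; have /andP[d0 d1] := delta01.
pose B := L_C * (T%:R + 1); have B0 : 0 < B by rewrite mulr_gt0//; lra.
(* The total rounding error is 4 L_C T eta = eps / 4. *)
pose eta := eps / (16 * L_C * T%:R).
have eta0 : 0 < eta by rewrite divr_gt0// !mulr_gt0//; lra.
pose K := (Num.truncn (T%:R / eta)).+1.
have /andP[K1 K2] := truncn_itv (divr_ge0 (ler0n R T) (ltW eta0)).
have etaK : T%:R <= K%:R * eta by rewrite -ler_pdivrMr// ltW.
pose u := L_C / eps; have u0 : 0 < u by rewrite divr_gt0.
have Tu1 : 1 <= T%:R * u.
  by rewrite /u mulrA ler_pdivlMr// mul1r mulrC ltW.
have K18 : K.+1%:R <= 18 * (T%:R ^+ 2 * u) :> R.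
  have Te : T%:R / eta = 16 * (T%:R ^+ 2 * u).
    by rewrite /eta /u; field; rewrite !gt_eqF//; lra.
  have : T%:R * (T%:R * u) >= 1 by rewrite -[leLHS]mulr1 ler_pM.
  by rewrite mulrA -expr2 /K -!natr1; move: K1; rewrite Te; lra.
(* The linearization error is 2 B kappa = eps / 4. *)
pose kappa := eps / (8 * B).
have k0 : 0 < kappa by rewrite divr_gt0// mulr_gt0.
have k2 : kappa <= 1 / 2.
  have eB : eps <= B by rewrite /B mulrDr mulr1 (le_trans (ltW LT))// lerDl ltW.
  rewrite ler_pdivrMr ?mulr_gt0//.
  by apply: (le_trans eB); rewrite mulrA ler_peMl ?(ltW B0)//; lra.
(* Then exp (-l) = x^(-32), the power available in [union_size_le]. *)
pose l := 32%:R * ln x; pose sgn (c : bool) : R := if c then kappa else - kappa.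
have sgn2 c : `|sgn c| <= 1 / 2 by rewrite /sgn; case: c; rewrite ?normrN gtr0_norm.
pose util i := utility T (f (rep i)) L_C.
have util1 i z : `|util i z| <= 1.
  by apply: utility_norm => // z1 z2; exact: fL.
pose V t i (k : 'I_K.+1) (s' : state M t.+1) : R :=
  value (@trans R T M) (util i) (T - t.+1) s' (k%:R * eta).
have V1 t i k (s' : state M t.+1) : (t < T)%N -> `|V t i k s'| <= 1.
  by move=> tT; apply: value_norm => //; rewrite subnKC.
pose J : finType := (stage_pair * 'I_K.+1 * bool * I)%type.
pose bad (j : J) : set Omega :=
  let: (p, k, c, i) := j in
  deviation X (tagged p).1 (tagged p).2 (fun s' => 1 - sgn c * V (tag p) i k s') l.
have badm j : measurable (bad j).
  by case: j => [[[[t [s a]] k] c] i]; exact: (deviation_measurable iid).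
have bad_le j : (Pr (bad j) <= (expR (- l))%:E)%E.
  case: j => [[[[t [s a]] k] c] i]; apply: (deviation_le iid) => [|s' /=].
    exact: ltn_ord.
  by apply: lt_le_trans (entropic_arg (sgn2 c) (V1 _ i k s' (ltn_ord t))).
have xE : x = T%:R ^+ 7 * S * A * u ^+ 3 * b * m ^+ d / delta.
  by rewrite /x /u; field; rewrite !gt_eqF.
have S2' : 2 <= S by rewrite ler_nat.
have A1' : 1 <= A by rewrite ler1n max_card_action_gt0.
have b7 : 7 / 12 <= b by exact: ln_max2_ge.
have x0 : 0 < x.
  have S0 : 0 < S := lt_le_trans (ltr0n R 2) S2'.
  have A0 : 0 < A := lt_le_trans (@ltr01 R) A1'.
  have m0 : 0 < m := lt_le_trans (ltr0n R 2) m2.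
  have b0 : 0 < b by apply: lt_le_trans b7; rewrite divr_gt0.
  have T7 : 0 < T%:R ^+ 7 :> R := exprn_gt0 _ Tr0.
  have u3 : 0 < u ^+ 3 := exprn_gt0 _ u0.
  have md : 0 < m ^+ d := exprn_gt0 _ m0.
  rewrite xE; apply: divr_gt0 => //.
  by do 5 apply: mulr_gt0 => //.
have union : #|J|%:R * expR (- l) <= delta.
  rewrite expRN /l expRM_natl lnK ?posrE// ler_pdivrMr ?exprn_gt0// xE.
  have k18 : 0 <= (K.+1%:R : R) <= 18 * (T%:R ^+ 2 * u) by rewrite K18 ler0n.
  have kI : 0 <= (#|I|%:R : R) <= (64 * m) ^+ d by rewrite card ler0n.
  apply: le_trans (union_size_le Tr S2' A1' Tu1 delta01 m2 b7 k18 kI).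
  rewrite !card_prod card_ord card_bool !natrM ler_wpM2r// ler_wpM2r// ler_wpM2r//.
  by rewrite /S /A -!natrM ler_nat card_stage_pair.
pose Bad := \big[setU/set0]_(j : J) bad j.
have Badm : measurable Bad by apply: bigsetU_measurable.
have PrBad : (Pr Bad <= delta%:E)%E.
  apply: le_trans (measure_bigsetU_le _ _ _ badm) _.
  apply: (@le_trans _ _ (\sum_(j : J) (expR (- l))%:E)%E).
    by apply: lee_sum => j _; exact: bad_le.
  by rewrite sumEFin lee_fin sumr_const -[leLHS]mulr_natl.
have good : ~` Bad `<=` [set w | forall s, close w s].
  move=> w nBad s.
  have nbad j : ~ bad j w.
    by move=> bj; apply: nBad; rewrite /Bad -bigcup_finType; exists j.
  have cal c i : grid_calibrated (@trans R T M) (empirical_kernel X w)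
      (util i) eta (l / n%:R) K (sgn c).
    move=> t s1 a k tT.
    have := nbad (Tagged (fun t : 'I_T => (state M t * action M t)%type)
      (i := Ordinal tT) (s1, a), k, c, i).
    exact: not_deviation.
  apply: (opt_risk_close fam L0 s (QD w) Trep cov _ eta0 etaK (cal true) (cal false)).
    by rewrite k0.
  rewrite -/B.
  (* The three terms are the linearization, sampling and rounding errors. *)
  have -> : B * (2 * kappa + T%:R * (l / n%:R + 4 * kappa / (T%:R + 1) * eta) / kappa) =
      eps / 4 + 8 * B ^+ 2 * T%:R * l / (n%:R * eps) + eps / 4.
    rewrite /kappa /eta /B; field.
    by rewrite !gt_eqF// ?ltr0n//; lra.
  suff : 8 * B ^+ 2 * T%:R * l / (n%:R * eps) <= eps / 4 by lra.
  rewrite ler_pdivrMr ?mulr_gt0 ?ltr0n//.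
  (* Here 4096 = 32 * 4 * 32: 8 over 1/4, the bound B^2 <= 4 L_C^2 T^2, and l = 32 ln x. *)
  have hn' : 4096 * (T%:R ^+ 3 * L_C ^+ 2 * ln x) <= n%:R * eps ^+ 2.
    rewrite -ler_pdivrMr ?exprn_gt0//; apply: le_trans hn.
    by rewrite le_eqVlt; apply/orP; left; apply/eqP; field; rewrite gt_eqF.
  have BT : B ^+ 2 <= 4 * (L_C ^+ 2 * T%:R ^+ 2).
    rewrite /B exprMn [leRHS]mulrCA ler_wpM2l ?sqr_ge0//.
    rewrite [leRHS](_ : _ = (T%:R + T%:R) ^+ 2); last by ring.
    by apply: lerXn2r; rewrite ?nnegrE ?addr_ge0// lerD2l.
  have [l0|l0] := leP 0 (ln x).
    have : B ^+ 2 * (T%:R * ln x) <= 4 * (L_C ^+ 2 * T%:R ^+ 2) * (T%:R * ln x).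
      by rewrite ler_wpM2r// mulr_ge0//; lra.
    by rewrite /l; lra.
  apply: (@le_trans _ _ 0).
    have l0' : l <= 0 by rewrite /l pmulr_rle0// ltW.
    have B2 := sqr_ge0 B.
    by apply: mulr_ge0_le0 => //; do 2 apply: mulr_ge0 => //.
  by rewrite !mulr_ge0 ?(ltW eps0)// invr_ge0.
apply: (@le_trans _ _ (Pr (~` Bad))).
  by rewrite probability_setC// EFinB leeB.
by apply: le_measure => //; rewrite inE; [exact: measurableC|exact: close_measurable].
Qed.
End Event.
End SampleComplexity.

Theorem theorem2p4 (R : realType) :
  exists C : R, 0 < C /\
  forall (T : nat) (M : mdp R T)
    (d_Theta : nat) (Theta : set 'rV[R]_d_Theta) (f : 'rV[R]_d_Theta -> R -> R)
    (L_C L_Theta R_Theta eps delta : R) (n : nat)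
    (disp : measure_display) (Omega : measurableType disp)
    (Pr : probability Omega R)
    (X : @samples R T M n disp Omega),
  (0 < T)%N ->
  risk_family_assumption T Theta f L_C L_Theta R_Theta ->
  0 < eps -> 0 < delta < 1 ->
  (0 < n)%N ->
  C * sample_complexity T (max_card_state M) (max_card_action M) d_Theta
        L_C L_Theta R_Theta eps delta <= n%:R ->
  iid_samples Pr X ->
  ((1 - delta)%:E <=
   Pr [set w | forall s : state M 0,
         (`|opt_risk Theta f (empirical_kernel X w) s
            - opt_risk Theta f (@trans R T M) s| <= eps)%R])%E.
Proof.
exists 4096; split; first by rewrite ltr0n.
move=> T M d Theta f L_C L_Theta R_Theta eps delta n.
move=> disp Omega Pr X T0 fam eps0 delta01 n0 hn iid.
have sure (E : set Omega) : (forall w, E w) -> ((1 - delta)%:E <= Pr E)%E.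
  move=> Ew; rewrite (_ : E = setT); last by apply/seteqP; split.
  by rewrite probability_setT lee_fin gerBl ltW//; case/andP: delta01.
(* Past these two cases, [eps < L_C * T] and |S| >= 2, the lower bounds that the union estimate
   requires. *)
have [LT|LT] := leP (L_C * T%:R) eps.
  by apply: sure => w s; exact: (close_of_small_L_C fam).
have [S1|S2] := leqP (max_card_state M) 1.
  by apply: sure => w s; exact: close_of_single_state.
exact: (close_probability fam).
Qed.
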